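(* Let $(X_1,d_1)$ and $(X_2,d_2)$ be proper geodesic hyperbolic metric spaces and let $z_1\in X_1$, $z_2\in X_2$. Let $$Y=(X_1,z_1)\times_h(X_2,z_2):=\{(x_1,x_2)\in X_1\times X_2 \mid d_1(x_1,z_1)=d_2(x_2,z_2)\},$$ equipped with the interior metric $d$ on $Y$ induced by the Euclidean product metric $d_e$. Then $(Y,d)$ is also a proper geodesic hyperbolic metric space, and its boundary at infinity $\partial Y$ is naturally homeomorphic to $\partial X_1\times\partial X_2$.
   Context: A metric space $(X,d)$ is geodesic if any two points $x,y$ can be joined by a geodesic segment, i.e. the image of a path from $x$ to $y$ parameterized by arclength on $[0,d(x,y)]$ which is an isometric embedding. It is proper if closed balls are compact. A geodesic metric space is $\delta$-hyperbolic if for every triangle with geodesic sides each side is contained in the $\delta$-neighborhood of the union of the other two sides; it is hyperbolic if it is $\delta$-hyperbolic for some $\delta\ge 0$. The Euclidean product metric on $X_1\times X_2$ is $d_e((x_1,x_2),(y_1,y_2))=\big(d_1(x_1,y_1)^2+d_2(x_2,y_2)^2\big)^{1/2}$. The interior metric on $Y$ is $d(x,y):=\inf\{L(c)\mid c \text{ a curve in } Y \text{ connecting } x \text{ to } y\}$, where $L(c)$ is the length of $c$ in $(Y,d_e)$. Boundary at infinity: for a hyperbolic space $(X,d)$ and $x,y,z\in X$ put $(x\cdot y)_z=\frac12[d(x,z)+d(y,z)-d(x,y)]$. Fix a basepoint $z\in X$. A sequence $\{x^k\}$ in $X$ converges to infinity if $\liminf_{k,l\to\infty}(x^k\cdot x^l)_z=\infty$.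 Two sequences $\{x^k\},\{y^k\}$ converging to infinity are equivalent if $\liminf_{k,l\to\infty}(x^k\cdot y^l)_z=\infty$. $\partial X$ is the set of equivalence classes $[\{x^k\}]$, with the topology generated by the sets $U(v,r)$, $v\in\partial X$, $r>0$, where $U(v,r)$ is the set of $w\in\partial X$ for which there exist $\{x^k\},\{y^k\}$ with $[\{x^k\}]=v$, $[\{y^k\}]=w$ and $\liminf_{k,l\to\infty}(x^k\cdot y^l)_z\ge r$. Products of boundaries carry the product topology. The word ''naturally'' is not given a separate formal definition; the formal content is the existence of the homeomorphism. *)

(* Defs.v *)
From HB Require Import structures.
From mathcomp Require Import all_boot all_order all_algebra.
From mathcomp Require Import all_classical all_reals all_analysis.
From mathcomp Require Import ring.

Set Implicit Arguments.
Unset Strict Implicit.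
Unset Printing Implicit Defensive.

Import Order.TTheory GRing.Theory Num.Theory.
Import numFieldNormedType.Exports.

Local Open Scope classical_set_scope.
Local Open Scope ring_scope.

Section GeodesicSpaces.
Context {R : realType}.
Implicit Type M : metricType R.

Definition geodesic_path M (x y : M) (g : R -> M) : Prop :=
  [/\ g 0 = x, g (mdist x y) = y &
      {in `[0, mdist x y] &, forall s t, mdist (g s) (g t) = `|s - t|}].

Definition geodesic_segment M (x y : M) (S : set M) : Prop :=
  exists2 g, geodesic_path x y g & S = g @` `[0, mdist x y].

Definition geodesic_space M : Prop :=
  forall x y : M, exists S, geodesic_segment x y S.

(* [closed_ball] of the library is the closure of the open ball, which can be
   smaller than the set used here. *)
Definition proper_space M : Prop :=
  forall (x : M) (r : R), compact [set y | mdist x y <= r].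

(* The neighborhood is taken with [<=], so that [delta = 0] is meaningful.  As
   the vertices and the sides are arbitrary, bounding one side bounds all. *)
Definition delta_hyperbolic M (delta : R) : Prop :=
  forall (x y z : M) (Sxy Syz Szx : set M),
    geodesic_segment x y Sxy -> geodesic_segment y z Syz ->
    geodesic_segment z x Szx ->
    forall p, Sxy p -> exists2 q, (Syz `|` Szx) q & mdist p q <= delta.

Definition hyperbolic_space M : Prop :=
  exists2 delta : R, 0 <= delta & delta_hyperbolic M delta.

End GeodesicSpaces.

Section InteriorMetric.
Context {R : realType}.
Implicit Type M : metricType R.

Definition polygonal_length M (a b : R) (c : R -> M) (s : seq R) : R :=
  let F := c \o nth b (a :: s) in
  \sum_(0 <= n < size s) mdist (F n) (F n.+1).

Definition curve_length M (a b : R) (c : R -> M) : \bar R :=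
  ereal_sup [set (polygonal_length a b c s)%:E | s in itv_partition a b].

Definition curve_in M (A : set M) (x y : M) (a b : R) (c : R -> M) : Prop :=
  [/\ a <= b, {within `[a, b], continuous c}, c a = x, c b = y &
      forall t, t \in `[a, b] -> A (c t)].

(* Equal to [+oo] when no rectifiable curve in [A] joins [x] to [y]. *)
Definition interior_dist M (A : set M) (x y : M) : \bar R :=
  ereal_inf [set l | exists a b c,
    curve_in A x y a b c /\ l = curve_length a b c].

(* [Y] is, through the bijection [i] onto [A], the set [A] with its interior
   metric; in particular interior distances between points of [A] are finite. *)
Definition is_interior_space M (A : set M) (Y : metricType R) (i : Y -> M)
    : Prop :=
  set_bij [set: Y] A i /\
  forall p q : Y, (mdist p q)%:E = interior_dist A (i p) (i q).

End InteriorMetric.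

(* The product with the Euclidean product metric; the alias avoids the
   sup-metric structure that the library puts on [M * N]. *)
Definition eprod {R : realType} (M N : metricType R) : Type := (M * N)%type.

Section EuclideanProduct.
Context {R : realType} (M N : metricType R).

HB.instance Definition _ := Choice.copy (eprod M N) (M * N)%type.

Definition eprod_dist (p q : eprod M N) : R :=
  Num.sqrt (mdist p.1 q.1 ^+ 2 + mdist p.2 q.2 ^+ 2).

Let eprod_distxx p : eprod_dist p p = 0.
Proof. by rewrite /eprod_dist !mdistxx expr0n/= addr0 sqrtr0. Qed.

Let eprod_dist_positivity p q : eprod_dist p q = 0 -> p = q.
Proof.
case: p q => [p1 p2] [q1 q2] /eqP; rewrite /eprod_dist sqrtr_eq0 /= => h.
have /eqP : mdist p1 q1 ^+ 2 + mdist p2 q2 ^+ 2 = 0.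
  by apply/eqP; rewrite eq_le h addr_ge0 ?sqr_ge0.
rewrite paddr_eq0 ?sqr_ge0// !sqrf_eq0 => /andP[/eqP e1 /eqP e2].
by rewrite (mdist_positivity _ _ e1) (mdist_positivity _ _ e2).
Qed.

Let eprod_dist_sym p q : eprod_dist p q = eprod_dist q p.
Proof. by rewrite /eprod_dist metric_sym [in X in _ + X]metric_sym. Qed.

Let sqrt_triangle (a b c d : R) :
  Num.sqrt ((a + b) ^+ 2 + (c + d) ^+ 2) <=
  Num.sqrt (a ^+ 2 + c ^+ 2) + Num.sqrt (b ^+ 2 + d ^+ 2).
Proof.
set u := a ^+ 2 + c ^+ 2; set v := b ^+ 2 + d ^+ 2.
have u0 : 0 <= u by rewrite addr_ge0// sqr_ge0.
have v0 : 0 <= v by rewrite addr_ge0// sqr_ge0.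
rewrite -[leRHS]ger0_norm ?addr_ge0 ?sqrtr_ge0// -sqrtr_sqr.
apply: ler_wsqrtr; rewrite [leRHS]sqrrD !sqr_sqrtr// -sqrtrM//.
have -> : (a + b) ^+ 2 + (c + d) ^+ 2 = u + (a * b + c * d) *+ 2 + v.
  by rewrite /u /v; ring.
rewrite lerD2r lerD2l lerMn2r/=.
apply: (le_trans (ler_norm _)); rewrite -sqrtr_sqr; apply: ler_wsqrtr.
rewrite -subr_ge0.
have -> : u * v - (a * b + c * d) ^+ 2 = (a * d - c * b) ^+ 2.
  by rewrite /u /v; ring.
exact: sqr_ge0.
Qed.

Let eprod_dist_triangle q p r :
  eprod_dist p r <= eprod_dist p q + eprod_dist q r.
Proof.
apply: le_trans (sqrt_triangle _ _ _ _); apply: ler_wsqrtr.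
by apply: lerD; rewrite ler_sqr ?nnegrE ?addr_ge0 ?mdist_ge0//;
  exact: metric_triangle.
Qed.

HB.instance Definition _ := isMetric.Build R (eprod M N)
  eprod_distxx eprod_dist_positivity eprod_dist_sym eprod_dist_triangle.

End EuclideanProduct.

Definition hyperbolic_product {R : realType} (M N : metricType R)
    (z1 : M) (z2 : N) : set (eprod M N) :=
  [set p | mdist p.1 z1 = mdist p.2 z2].

Section Boundary.
Context {R : realType}.
Implicit Type M : metricType R.

Definition gromov_product M (z x y : M) : R :=
  (mdist x z + mdist y z - mdist x y) / 2.

Definition gromov_liminf M (z : M) (x y : nat -> M) : \bar R :=
  limf_einf (fun kl : nat * nat => (gromov_product z (x kl.1) (y kl.2))%:E)
            (filter_prod \oo \oo).

Definition cvg_infty M (z : M) (x : nat -> M) : Prop :=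
  gromov_liminf z x x = +oo%E.

Definition equiv_infty M (z : M) (x y : nat -> M) : Prop :=
  gromov_liminf z x y = +oo%E.

Definition boundary_class M (z : M) (x : nat -> M) : set (nat -> M) :=
  [set y | cvg_infty z y /\ equiv_infty z x y].

Definition boundary_classes M (z : M) : set (set (nat -> M)) :=
  [set boundary_class z x | x in cvg_infty z].

Definition boundary M (z : M) : Type := set_type (boundary_classes z).

HB.instance Definition _ M (z : M) :=
  Choice.copy (boundary z) (set_type (boundary_classes z)).

Definition boundary_nbhd M (z : M) (v : boundary z) (r : R)
    : set (boundary z) :=
  [set w | exists x y : nat -> M,
    [/\ set_val v x, set_val w y & (r%:E <= gromov_liminf z x y)%E]].

(* The sets [boundary_nbhd v r], [r > 0], generate the topology as a system of
   neighborhoods of [v].  They need not be open: taking them as a subbase of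
   open sets would make the boundary of the hyperbolic plane, where they are
   closed arcs, discrete. *)
Definition boundary_open M (z : M) (W : set (boundary z)) : Prop :=
  forall v, W v -> exists2 r : R, 0 < r & boundary_nbhd v r `<=` W.

Let boundary_openT M (z : M) : boundary_open [set: boundary z].
Proof. by move=> v _; exists 1. Qed.

Let boundary_openI M (z : M) : setI_closed (@boundary_open M z).
Proof.
move=> A B oA oB v [/oA[r r0 rA] /oB[s s0 sB]].
exists (Num.max r s); first by rewrite lt_max r0.
move=> w [x [y [vx wy h]]]; split; [apply: rA | apply: sB];
  exists x, y; split => //; apply: le_trans h;
  by rewrite lee_fin le_max lexx ?orbT.
Qed.

Let boundary_open_bigU M (z : M) (I : Type) (f : I -> set (boundary z)) :
  (forall i, boundary_open (f i)) -> boundary_open (\bigcup_i f i).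
Proof.
move=> of_ v [i _ /of_[r r0 rf]]; exists r => // w /rf fw.
by exists i.
Qed.

HB.instance Definition _ M (z : M) := isOpenTopological.Build (boundary z)
  (@boundary_openT M z) (@boundary_openI M z) (@boundary_open_bigU M z).

End Boundary.

Definition homeomorphic (S T : topologicalType) : Prop :=
  exists (f : S -> T) (g : T -> S),
    [/\ cancel f g, cancel g f, continuous f & continuous g].

(* Main.v *)
Require Import Defs.
From HB Require Import structures.
From mathcomp Require Import all_boot all_order all_algebra.
From mathcomp Require Import all_classical all_reals all_analysis.
From mathcomp Require Import ring lra zify.

(* The interior metric [d] of the product differs by a bounded amount from
   [sqrt 2 * max d1 d2], so its Gromov products are, up to a bounded error,
   [sqrt 2] times the minimum of those of the factors, and both hyperbolicity
   and the boundary can be read off from this.  Call height the distance to the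
   base point.
   Upper bound: from both points descend along geodesics to a height slightly
   below the two Gromov products, where the geodesics are close to each other,
   and cross there one coordinate at a time, the other coordinate following the
   change of height along a geodesic.
   Lower bound: the length of a path is at least [sqrt 2] times its variation of
   height, and a path that stays high above the level of the Gromov product of
   its ends has a length exponential in the difference. *)

Set Implicit Arguments.
Unset Strict Implicit.
Unset Printing Implicit Defensive.

Import Order.TTheory GRing.Theory Num.Theory.
Import numFieldNormedType.Exports.
Import metricType_numDomainType.

Local Open Scope classical_set_scope.
Local Open Scope ring_scope.

(** * Geodesics as ultralimits *)

(** Three circumstances shape the argument. The interior metric need not a priori induce the product
    topology, while the estimate from below runs along geodesics of the product. Properness and
    geodesics of the product are therefore settled before distances are compared, from the fact that
    nearby points of the set are joined by short curves inside it. Hyperbolicity is carried by the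
    four-point inequality instead of thin triangles: sides of a triangle in the product need not
    project to geodesics, whereas the four-point inequality passes to the minimum of two Gromov
    products and tolerates bounded errors and changes of base point. The factor [sqrt 2] is the
    Euclidean speed of a pair of unit-speed paths. The minimum of the Gromov products appears
    because both coordinates of a point have the same height, which turns a maximum of distances
    into a minimum of products. *)

Section Ultralimits.
Context {R : realType} {M : metricType R}.
Hypothesis pM : proper_space M.

(** Ultrafilters replace the extraction of subsequences: the image ultrafilter contains a compact
    ball, hence has a cluster point, and a cluster point of an ultrafilter is a limit. *)
Lemma proper_ultra_cvg (I : Type) (U : set_system I) (f : I -> M) (x : M)
    (r : R) :
  UltraFilter U -> (\forall i \near U, mdist x (f i) <= r) ->
  exists p : M, f i @[i --> U] --> p.
Proof.
move=> UU fr.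
have /pM[p [_ fp]] : (f @ U) [set y | mdist x y <= r] by [].
exists p => B pB; have [//|UB] := in_ultra_setVsetC (f @^-1` B) UU.
have [q [/= nBq Bq]] := fp (~` B) B UB pB.
by case: nBq.
Qed.

Lemma cvg_mdist_le (I : Type) (U : set_system I) (f g : I -> M) (p q : M)
    (c : R) :
  ProperFilter U -> f i @[i --> U] --> p -> g i @[i --> U] --> q ->
  (forall e, 0 < e -> \forall i \near U, mdist (f i) (g i) <= c + e) ->
  mdist p q <= c.
Proof.
move=> UU /cvgrPdist_lt fp /cvgrPdist_lt gq fg; apply/ler_addgt0Pr => e e0.
have e3 : 0 < e / 3 by lra.
have [i [[/= h1 h2] h3]] :=
  filter_ex (filterI (filterI (fp _ e3) (gq _ e3)) (fg _ e3)).
have := metric_triangle p (f i) q; have := metric_triangle (f i) (g i) q.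
by rewrite (metric_sym (g i) q); lra.
Qed.

Lemma limit_geodesic (I : Type) (U : set_system I) (g : I -> R -> M) (x y : M) :
  UltraFilter U -> g i 0 @[i --> U] --> x -> g i (mdist x y) @[i --> U] --> y ->
  (forall e, 0 < e -> \forall i \near U,
    {in `[0, mdist x y] &,
      forall s t, mdist (g i s) (g i t) <= `|s - t| + e}) ->
  exists2 h, geodesic_path x y h &
    {in `[0, mdist x y], forall t, g i t @[i --> U] --> h t}.
Proof.
move=> UU gx gy gL; set D := mdist x y in gy gL *.
have D0 : 0 <= D by exact: mdist_ge0.
have lim t : t \in `[0, D] -> exists p : M, g i t @[i --> U] --> p.
  move=> tD; apply: (@proper_ultra_cvg _ _ _ x (D + 2)) => //.
  have /cvgrPdist_lt/(_ 1 ltr01) h := gx.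
  apply: filterS2 h (gL 1 ltr01) => i /= h1 h2.
  have := h2 0 t; rewrite sub0r normrN in_itv/= lexx D0 => /(_ isT tD).
  have := metric_triangle x (g i 0) (g i t).
  by move: tD; rewrite in_itv/= => /andP[t0 tD]; rewrite ger0_norm//; lra.
pose h t := if pselect (t \in `[0, D]) is left tD then sval (cid (lim t tD))
  else x.
have hP : {in `[0, D], forall t, g i t @[i --> U] --> h t}.
  by move=> t tD; rewrite /h; case: pselect => // H; case: cid.
have hle : {in `[0, D] &, forall s t, mdist (h s) (h t) <= `|s - t|}.
  move=> s t sD tD; apply: cvg_mdist_le (hP _ sD) (hP _ tD) _ => e e0.
  by apply: filterS (gL e e0) => i /(_ s t sD tD).
have in0 : 0 \in `[0, D] by rewrite in_itv/= lexx.
have inD : D \in `[0, D] by rewrite in_itv/= lexx D0.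
have h0 : h 0 = x.
  exact: (cvg_unique (@metric_hausdorff _ M) (hP _ in0) gx).
have hD : h D = y.
  exact: (cvg_unique (@metric_hausdorff _ M) (hP _ inD) gy).
exists h => //; split => //.
(* The limit is 1-Lipschitz and its end points are at distance [D], the length of the interval, so
   the triangle inequality leaves no room for a loss between [s] and [t]. *)
have key : {in `[0, D] &, forall s t, s <= t -> `|s - t| <= mdist (h s) (h t)}.
  move=> s t sD tD st.
  have := hle _ _ in0 sD; have := hle _ _ tD inD; rewrite h0 hD.
  have := metric_triangle x (h s) y; have := metric_triangle (h s) (h t) y.
  rewrite -/D; move: sD tD; rewrite !in_itv/= => /andP[? ?] /andP[? ?].
  by rewrite !ler0_norm; lra.
move=> s t sD tD; apply/eqP; rewrite eq_le hle//=.
have [st|/ltW st] := leP s t; first exact: key.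
by rewrite distrC metric_sym key.
Qed.

End Ultralimits.

Section GeodesicFromMidpoints.
Context {R : realType} {M : metricType R}.
Hypothesis pM : proper_space M.
Hypothesis approx_between : forall (x y : M) (t e : R), 0 <= t <= mdist x y ->
  0 < e -> exists w, mdist x w <= t + e /\ mdist w y <= mdist x y - t + e.

Let ultra_right0 : exists U : set_system R, UltraFilter U /\ 0^'+ `<=` U.
Proof. exact: ultraFilterLemma. Qed.

Let between (x y : M) (t : R) : 0 <= t <= mdist x y ->
  exists w, mdist x w <= t /\ mdist w y <= mdist x y - t.
Proof.
move=> tD; have [U [UU U0]] := ultra_right0.
pose w e := if pselect (0 < e) is left e0 then
  sval (cid (approx_between tD e0)) else x.
have wP e : 0 < e ->
    mdist x (w e) <= t + e /\ mdist (w e) y <= mdist x y - t + e.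
  by move=> e0; rewrite /w; case: pselect => // e0'; case: cid.
have U_lt e : 0 < e -> \forall d \near U, 0 < d <= e.
  move=> e0; apply: U0; near=> d; apply/andP; split.
    by near: d; exact: nbhs_right_gt.
  by near: d; exact: nbhs_right_le.
have [p wp] : exists p : M, w e @[e --> U] --> p.
  apply: (@proper_ultra_cvg _ _ pM _ _ _ x (t + 1)).
  by apply: filterS (U_lt 1 ltr01) => d /andP[d0 d1]; have := wP d d0; lra.
exists p; split.
  apply: cvg_mdist_le (cvg_cst x) wp _ => e e0.
  by apply: filterS (U_lt e e0) => d /andP[d0 d1]; have := wP d d0; lra.
apply: cvg_mdist_le wp (cvg_cst y) _ => e e0.
by apply: filterS (U_lt e e0) => d /andP[d0 d1]; have := wP d d0; lra.
Unshelve. all: by end_near. Qed.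

(** Walking from [x] towards [y] in steps of size [h] gives a step function that is 1-Lipschitz up
    to [h]; its ultralimit as [h] tends to [0] from the right is a geodesic. *)
Lemma proper_approx_between_geodesic : geodesic_space M.
Proof.
move=> x y; set D := mdist x y.
have [U [UU U0]] := ultra_right0.
(* The minimum makes the walk jump to [y] and stay there once [y] is within [h]. *)
pose step (h : R) u : M :=
  if pselect (0 <= Num.min h (mdist u y) <= mdist u y) is left H
  then sval (cid (between H)) else u.
pose p (h : R) n := iter n (step h) x.
have stepP h u : 0 < h -> mdist u (step h u) <= h /\
    mdist (step h u) y <= Num.max 0 (mdist u y - h).
  move=> h0; rewrite /step; case: pselect => [H|]; last first.
    by case; rewrite ge_min lexx orbT le_min mdist_ge0 ltW.
  case: cid => w /= [w1 w2]; move: w1 w2.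
  have [hD|hD] := leP h (mdist u y).
    by move=> w1 w2; split => //; rewrite le_max w2 orbT.
  by rewrite subrr => w1 w2; rewrite le_max w2; split => //; lra.
have pD h n : 0 < h -> mdist (p h n) y <= Num.max 0 (D - n%:R * h).
  move=> h0; elim: n => [|n IH]; first by rewrite mul0r subr0 le_max lexx orbT.
  have [_] := stepP _ (p h n) h0; rewrite -[step _ _]/(p h n.+1) => H.
  apply: le_trans H _; rewrite ge_max !le_max lexx/= -natr1 mulrDl mul1r.
  move: IH; rewrite le_max => /orP[IH|IH]; apply/orP; [left|right]; lra.
have pL h m n : 0 < h -> mdist (p h n) (p h (n + m)%N) <= m%:R * h.
  move=> h0; elim: m => [|m IH]; first by rewrite addn0 mdistxx mul0r.
  have [H _] := stepP _ (p h (n + m)%N) h0; move: H.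
  rewrite -[step _ _]/(p h (n + m)%N.+1) -addnS => H.
  have := metric_triangle (p h n) (p h (n + m)%N) (p h (n + m.+1)%N).
  by rewrite -[m.+1%:R]natr1 mulrDl; lra.
have U_lt e : 0 < e -> \forall d \near U, 0 < d <= e.
  move=> e0; apply: U0; near=> d; apply/andP; split.
    by near: d; exact: nbhs_right_gt.
  by near: d; exact: nbhs_right_le.
pose g (h t : R) := p h (Num.truncn (t / h)).
have tr (h t : R) : 0 < h -> 0 <= t ->
    (Num.truncn (t / h))%:R * h <= t < (Num.truncn (t / h))%:R * h + h.
  move=> h0 t0.
  have : (Num.truncn (t / h))%:R <= t / h < (Num.truncn (t / h)).+1%:R.
    by apply: truncn_itv; rewrite divr_ge0// ltW.
  by rewrite ler_pdivlMr// ltr_pdivrMr// -natr1 mulrDl mul1r.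
have D0 : 0 <= D by exact: mdist_ge0.
have g0 : g h 0 @[h --> U] --> x.
  have -> : (g^~ 0) = cst x by apply/funext => h; rewrite /g mul0r truncn0.
  exact: cvg_cst.
have gD : g h D @[h --> U] --> y.
  apply/cvgrPdist_le => e e0; apply: filterS (U_lt e e0) => h /andP[h0 he].
  rewrite metric_sym; apply: le_trans (pD _ _ h0) _.
  by rewrite ge_max ltW//=; have := tr h D h0 D0; lra.
have gL e : 0 < e -> \forall h \near U, {in `[0, D] &, forall s t,
    mdist (g h s) (g h t) <= `|s - t| + e}.
  move=> e0; apply: filterS (U_lt e e0) => h /andP[h0 he].
  have key : {in `[0, D] &, forall s t, s <= t ->
      mdist (g h s) (g h t) <= `|s - t| + e}.
    move=> s t; rewrite !in_itv/= => /andP[s0 _] /andP[t0 _] st.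
    have le : (Num.truncn (s / h) <= Num.truncn (t / h))%N.
      by apply: le_truncn; rewrite ler_pM2r// invr_gt0.
    rewrite /g -(subnKC le); apply: le_trans (pL _ _ _ h0) _.
    rewrite natrB// mulrBl ler0_norm; last lra.
    by have := tr h s h0 s0; have := tr h t h0 t0; lra.
  move=> s t sD tD; have [st|/ltW st] := leP s t; first exact: key.
  by rewrite distrC metric_sym key.
have [h gh _] := limit_geodesic pM UU g0 gD gL.
by exists (h @` `[0, D]); exists h.
Unshelve. all: by end_near. Qed.

End GeodesicFromMidpoints.

(** * The four-point condition *)

Section GromovProduct.
Context {R : realType} {M : metricType R}.
Implicit Types (x y z w : M) (g : R -> M).

(** Gromov's form of hyperbolicity, at a single base point. *)
Definition four_point (z : M) (k : R) : Prop := forall x y w,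
  Num.min (gromov_product z x w) (gromov_product z w y) - k <=
  gromov_product z x y.

Lemma gromov_productC z x y : gromov_product z x y = gromov_product z y x.
Proof. by rewrite /gromov_product (metric_sym x y); congr (_ / _); ring. Qed.

Lemma gromov_product_ge0 z x y : 0 <= gromov_product z x y.
Proof.
rewrite /gromov_product; have := metric_triangle x z y.
by rewrite (metric_sym z y); lra.
Qed.

Lemma gromov_product_le z x y : gromov_product z x y <= mdist x z.
Proof.
rewrite /gromov_product; have := metric_triangle y x z.
by rewrite (metric_sym y x); lra.
Qed.

Lemma gromov_product_base b z x y :
  `|gromov_product b x y - gromov_product z x y| <= mdist b z.
Proof.
rewrite ler_norml /gromov_product.
have := metric_triangle x b z; have := metric_triangle x z b.
have := metric_triangle y b z; have := metric_triangle y z b.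
by rewrite (metric_sym z b); lra.
Qed.

Lemma four_pointW z (k k' : R) : k <= k' -> four_point z k -> four_point z k'.
Proof. by move=> kk' f x y w; apply: le_trans (f x y w);
  rewrite lerD2l lerN2. Qed.

Lemma geodesic_spaceP x y : geodesic_space M -> exists g, geodesic_path x y g.
Proof. by move=> /(_ x y)[_ [g gP _]]; exists g. Qed.

Lemma geodesic_path_dist x y g s t : geodesic_path x y g ->
  0 <= s <= mdist x y -> 0 <= t <= mdist x y -> mdist (g s) (g t) = `|s - t|.
Proof. by move=> [_ _ gL] sD tD; rewrite gL// in_itv. Qed.

Lemma geodesic_path_distl x y g t : geodesic_path x y g ->
  0 <= t <= mdist x y -> mdist x (g t) = t.
Proof.
move=> gP; have [g0 _ _] := gP => tD.
rewrite -{1}g0 (geodesic_path_dist gP)// ?lexx ?mdist_ge0//.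
by rewrite sub0r normrN ger0_norm//; case/andP: tD.
Qed.

Lemma geodesic_path_distr x y g t : geodesic_path x y g ->
  0 <= t <= mdist x y -> mdist (g t) y = mdist x y - t.
Proof.
move=> gP; have [_ gD _] := gP => tD.
rewrite -{1}gD (geodesic_path_dist gP)// ?lexx ?mdist_ge0//.
by rewrite distrC ger0_norm// subr_ge0; case/andP: tD.
Qed.

Lemma geodesic_path_segment x y g : geodesic_path x y g ->
  geodesic_segment x y (g @` `[0, mdist x y]).
Proof. by exists g. Qed.

(** The point of the side [x y] where the comparison tripod of [x y z] branches is within
    [gromov_product z x y + 2 * delta] of [z]. It is also [delta]-close to one of the sides [y w],
    [w x], and a geodesic from [a] to [b] stays at distance at least [gromov_product z a b] from
    [z]. *)
Lemma delta_hyperbolic_four_point z (delta : R) :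
  geodesic_space M -> 0 <= delta -> delta_hyperbolic M delta ->
  four_point z (3 * delta).
Proof.
move=> gM d0 hM x y w.
have [gxy Gxy] := geodesic_spaceP x y gM;
  have [gyz Gyz] := geodesic_spaceP y z gM.
have [gzx Gzx] := geodesic_spaceP z x gM;
  have [gyw Gyw] := geodesic_spaceP y w gM.
have [gwx Gwx] := geodesic_spaceP w x gM.
pose t := gromov_product x z y.
have tD : 0 <= t <= mdist x y.
  by rewrite gromov_product_ge0 /t gromov_productC (metric_sym x y)
    gromov_product_le.
have Sp : (gxy @` `[0, mdist x y]) (gxy t) by exists t => //=; rewrite in_itv.
have tE : t = (mdist z x + mdist y x - mdist z y) / 2 by [].
have zp : mdist z (gxy t) <= gromov_product z x y + 2 * delta.
  have px := geodesic_path_distl Gxy tD; have py := geodesic_path_distr Gxy tD.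
  rewrite /gromov_product.
  have [u [|] [s /=] + <-{u}] := hM _ _ _ _ _ _ (geodesic_path_segment Gxy)
    (geodesic_path_segment Gyz) (geodesic_path_segment Gzx) _ Sp;
    rewrite in_itv/= => sD pu.
  - have := geodesic_path_distl Gyz sD; have := geodesic_path_distr Gyz sD.
    have := metric_triangle y (gyz s) (gxy t).
    have := metric_triangle z (gyz s) (gxy t).
    rewrite (metric_sym z (gyz s)) (metric_sym (gyz s) (gxy t)).
    move: px py tE pu; rewrite (metric_sym y (gxy t)) (metric_sym z x).
    by rewrite (metric_sym z y) (metric_sym y x); lra.
  have := geodesic_path_distl Gzx sD; have := geodesic_path_distr Gzx sD.
  have := metric_triangle x (gzx s) (gxy t).
  have := metric_triangle z (gzx s) (gxy t).
  rewrite (metric_sym (gzx s) (gxy t)) (metric_sym x (gzx s)).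
  move: px py tE pu; rewrite (metric_sym z x) (metric_sym z y) (metric_sym y x).
  by lra.
have gle (a b : M) g s : geodesic_path a b g -> s \in `[0, mdist a b] ->
    gromov_product z a b <= mdist z (g s).
  move=> gP; rewrite in_itv/= => sD; rewrite /gromov_product.
  have := geodesic_path_distl gP sD; have := geodesic_path_distr gP sD.
  have := metric_triangle a (g s) z; have := metric_triangle b (g s) z.
  by rewrite (metric_sym b (g s)) (metric_sym z (g s)); lra.
have [u [|] [s /=] sD <-{u} pu] := hM _ _ _ _ _ _ (geodesic_path_segment Gxy)
    (geodesic_path_segment Gyw) (geodesic_path_segment Gwx) _ Sp.
- have := gle _ _ _ _ Gyw sD; have := metric_triangle z (gxy t) (gyw s).
  by rewrite lerBlDr ge_min (gromov_productC z w y) => *; apply/orP; right; lra.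
have := gle _ _ _ _ Gwx sD; have := metric_triangle z (gxy t) (gwx s).
by rewrite lerBlDr ge_min (gromov_productC z x w) => *; apply/orP; left; lra.
Qed.

(** The form without base point. It combines four instances of the inequality at [z]; the constant
    is twice the [2 * k] that holds when [z] is one of the four points. *)
Lemma four_point_dist z (k : R) x y u w : four_point z k ->
  mdist x y + mdist u w <=
  Num.max (mdist x u + mdist y w) (mdist x w + mdist y u) + 4 * k.
Proof.
move=> fM; have := fM x y u; have := fM x y w; have := fM u w x;
  have := fM u w y.
rewrite /gromov_product (metric_sym u x) (metric_sym u y) (metric_sym w y).
rewrite !lerBlDr !ge_min => h1 h2 h3 h4.
rewrite leNgt -ltrBrDr gt_max; apply/negP => /andP[].
by case/orP: h1 => ?; case/orP: h2 => ?; case/orP: h3 => ?; case/orP: h4; lra.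
Qed.

(** Applied to the vertices and a point [p] of the side [x y], the four-point inequality says that
    [p] lies on a geodesic [y w] or [x w] up to an excess of [4 * k]. A second application, to [p]
    and the point of that side at the same distance from its origin, costs another [4 * k]. *)
Lemma four_point_hyperbolic z (k : R) : geodesic_space M -> 0 <= k ->
  four_point z k -> hyperbolic_space M.
Proof.
move=> gM k0 fM; exists (8 * k); first by lra.
move=> x y w Sxy Syw Swx [gxy Gxy ->] [gyw Gyw ->] [gwx Gwx ->] _ [t /= + <-].
rewrite in_itv/= => tD; set p := gxy t.
have side a b g s q : geodesic_path a b g -> mdist a q = s ->
    0 <= s -> mdist q b + s <= mdist a b + 4 * k ->
    exists2 u, (g @` `[0, mdist a b]) u & mdist q u <= 8 * k.
  move=> gP aq s0 sk; have [sD|sD] := leP s (mdist a b).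
    exists (g s); first by exists s => //=; rewrite in_itv/= s0.
    have s0D : 0 <= s <= mdist a b by rewrite s0.
    have := four_point_dist q (g s) a b fM; rewrite -lerBlDr le_max.
    have := geodesic_path_distl gP s0D; have := geodesic_path_distr gP s0D.
    by rewrite (metric_sym q a) (metric_sym (g s) a) => ? ? /orP[]; lra.
  exists b; last by lra.
  by exists (mdist a b) => /=; [rewrite in_itv/= lexx mdist_ge0|case: gP].
have px := geodesic_path_distl Gxy tD; have py := geodesic_path_distr Gxy tD.
have := four_point_dist x y p w fM; rewrite -lerBlDr le_max => /orP[h|h].
- have [|u Su pu] := side y w gyw (mdist y p) p Gyw erefl (mdist_ge0 _ _).
    by rewrite (metric_sym y p); rewrite -/p in px py; lra.
  by exists u => //; left.
(* [side] measures from the vertex shared with the side of [p], so the geodesic from [w] to [x] is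
   run backwards. *)
have [g' [G' G'S]] : exists g', geodesic_path x w g' /\
    g' @` `[0, mdist x w] `<=` gwx @` `[0, mdist w x].
  exists (fun s => gwx (mdist w x - s));
    rewrite /geodesic_path (metric_sym x w).
  case: (Gwx) => gw gx gL; split.
    split; rewrite ?subr0 ?subrr//.
    move=> a b; rewrite !in_itv/= => aD bD; rewrite gL ?in_itv/=; first last.
    - by lra.
    - by lra.
    by rewrite distrC; congr `|_|; ring.
  move=> _ [s /= + <-]; rewrite in_itv/= => sD.
  exists (mdist w x - s) => //=; rewrite in_itv/= subr_ge0 gerBl.
  by rewrite andbC.
have [|u Su pu] := side x w g' (mdist x p) p G' erefl (mdist_ge0 _ _).
  by rewrite (metric_sym y p) in h; rewrite -/p in px py; lra.
by exists u => //; right; exact: G'S.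
Qed.

(** Along [g h], [x], [y], [g' h] the consecutive Gromov products are at least [h]. Two uses of the
    four-point inequality give at least [h - 2 * k] between [g h] and [g' h], both of height [h]. *)
Lemma geodesic_fellow_travel z (k h : R) x y g g' : four_point z k -> 0 <= k ->
  geodesic_path z x g -> geodesic_path z y g' ->
  0 <= h <= gromov_product z x y -> mdist (g h) (g' h) <= 4 * k.
Proof.
move=> fM k0 gP g'P /andP[h0 hxy].
have hx : 0 <= h <= mdist z x.
  by rewrite h0 (le_trans hxy)// (metric_sym z) gromov_product_le.
have hy : 0 <= h <= mdist z y.
  rewrite h0 (le_trans hxy)// (metric_sym z) gromov_productC.
  exact: gromov_product_le.
have := fM (g h) y x; have := fM (g h) (g' h) y.
move: hxy; rewrite /gromov_product.
have := geodesic_path_distl gP hx; have := geodesic_path_distr gP hx.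
have := geodesic_path_distl g'P hy; have := geodesic_path_distr g'P hy.
rewrite !(metric_sym _ z) (metric_sym y (g' h)).
by rewrite !lerBlDr !ge_min -!lerBlDr => ? ? ? ? ?; do 2!(case/orP=> ?); lra.
Qed.

End GromovProduct.

(** * Lengths of curves and the interior metric *)

Section Curves.
Context {R : realType} {M : metricType R}.
Implicit Types (A : set M) (x y : M) (c : R -> M) (a b l : R) (s : seq R).

Fixpoint chain_length (c : R -> M) (a : R) (s : seq R) : R :=
  if s is t :: s' then mdist (c a) (c t) + chain_length c t s' else 0.

Lemma polygonal_lengthE a b c s : polygonal_length a b c s = chain_length c a s.
Proof.
elim: s a => [a|t s IH a]; first by rewrite /polygonal_length big_geq.
by rewrite /polygonal_length /= big_nat_recl//= -IH.
Qed.

Lemma chain_length_cat c a s t :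
  chain_length c a (s ++ t) = chain_length c a s + chain_length c (last a s) t.
Proof. by elim: s a => [|u s IH] a /=; rewrite ?add0r// IH addrA. Qed.

Lemma eq_chain_length c c' a b s : itv_partition a b s ->
  {in `[a, b], c =1 c'} -> chain_length c a s = chain_length c' a s.
Proof.
elim: s a => //= t s IH a abs cc'; have ts := itv_partition_cons abs.
have at_ : a <= t by case: abs => /= /andP[/ltW].
have tb := itv_partition_le ts.
rewrite (IH t)//; last first.
  by move=> u; rewrite in_itv/= => /andP[tu ub]; rewrite cc'// in_itv/=; lra.
by rewrite !cc'// in_itv/= ?lexx//= ?at_//= (le_trans at_).
Qed.

Lemma chain_length_split c a m b s : a <= m <= b -> itv_partition a b s ->
  exists s1 s2, [/\ itv_partition a m s1, itv_partition m b s2 &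
    chain_length c a s <= chain_length c a s1 + chain_length c m s2].
Proof.
elim: s a => [|t s IH] a amb abs.
  have ab := itv_partition_nil abs; have ma : m = a by rewrite -ab in amb; lra.
  by exists [::], [::]; rewrite -ab ma /= addr0; split => //; split => //=.
have ts := itv_partition_cons abs.
have at_ : a < t by case: abs => /= /andP[].
have [tm|mt] := leP t m.
  have [|s1 [s2 [h1 h2 h3]]] := IH t _ ts; first by case/andP: amb => _ ->;
    rewrite tm.
  exists (t :: s1), s2; split => //; last by rewrite /= -addrA lerD2l.
  by case: h1 => h1 h1'; split => //=; rewrite at_.
clear IH; case/andP: amb; rewrite le_eqVlt => /predU1P[<-{m mt} _|am mb].
  by exists [::], (t :: s); rewrite add0r.
exists [:: m], (t :: s); split.
- by split => //=; rewrite am.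
- by case: abs => /= /andP[_ abs] lb; split => //=; rewrite mt.
by rewrite /= addr0 addrA lerD2r metric_triangle.
Qed.

Lemma chain_length_opp c a b s : itv_partition a b s -> exists t,
  itv_partition (- b) (- a) t /\
  chain_length (c \o -%R) (- b) t = chain_length c a s.
Proof.
elim: s a => [|u s IH] a abs.
  by rewrite (itv_partition_nil abs); exists [::]; split => //; split => //=.
have [t [tP tE]] := IH _ (itv_partition_cons abs).
have au : a < u by case: abs => /= /andP[].
exists (t ++ [:: - a]); split.
  by apply: itv_partition_cat tP _; apply: itv_partition1; rewrite ltrN2.
rewrite chain_length_cat tE /= addr0; case: tP => _ /eqP ->.
by rewrite !opprK addrC metric_sym.
Qed.

Lemma chain_length_shift c (h : R) a b s : itv_partition a b s -> exists t,
  itv_partition (a + h) (b + h) t /\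
  chain_length c (a + h) t = chain_length (fun u => c (u + h)) a s.
Proof.
elim: s a => [|u s IH] a abs.
  by rewrite (itv_partition_nil abs); exists [::]; split => //; split => //=.
have [t [tP tE]] := IH _ (itv_partition_cons abs).
have au : a < u by case: abs => /= /andP[].
exists (u + h :: t); split; last by rewrite /= tE.
by case: tP => t1 t2; split => //=; rewrite ltrD2r au.
Qed.

Lemma within_itv_continuousP c a b : {within `[a, b], continuous c} <->
  forall u : R, a <= u <= b -> forall e : R, 0 < e -> exists2 h : R, 0 < h &
    forall t : R, a <= t <= b -> `|u - t| < h -> mdist (c u) (c t) < e.
Proof.
rewrite subspace_continuousP; split=> H u; last first.
  rewrite /= in_itv/= => uab; apply/cvgrPdist_lt => e e0.
  have [h h0 hP] := H u uab e e0.
  rewrite near_withinE; apply/nbhs_ballP; exists h => //= t ut.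
  by rewrite in_itv/= => tab; exact: hP.
move=> uab e e0; have := H u;
  rewrite /= in_itv/= => /(_ uab)/cvgrPdist_lt/(_ e e0).
rewrite near_withinE => /nbhs_ballP[h /= h0 hP]; exists h => // t tab ut.
by apply: hP => //; rewrite in_itv.
Qed.

(** A real bound on all inscribed polygons stands in for the length, so that no extended real and no
    supremum is carried through the constructions of curves. *)
Definition joins A x y (l : R) : Prop := exists a b c, curve_in A x y a b c /\
  forall s, itv_partition a b s -> chain_length c a s <= l.

Lemma joins_dist A x y l : joins A x y l -> mdist x y <= l.
Proof.
move=> [a [b [c [[ab _ <- <- _] H]]]].
have [nab|nab] := eqVneq a b.
  by rewrite nab mdistxx; apply: (H [::]); split => //=; rewrite nab.
have /H : itv_partition a b [:: b] by apply: itv_partition1;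
  rewrite lt_neqAle nab.
by rewrite /= addr0.
Qed.

Lemma joinsW A x y l l' : l <= l' -> joins A x y l -> joins A x y l'.
Proof.
move=> ll' [a [b [c [cP H]]]]; exists a, b, c; split => // s sP.
exact: le_trans (H s sP) ll'.
Qed.

Lemma joins_lipschitz A c a b (K : R) : 0 <= K -> a <= b ->
  (forall s t : R, a <= s <= b -> a <= t <= b ->
    mdist (c s) (c t) <= K * `|s - t|) ->
  (forall t, a <= t <= b -> A (c t)) -> joins A (c a) (c b) (K * (b - a)).
Proof.
move=> K0 ab cL cA; exists a, b, c; split.
  split => //.
  apply/within_itv_continuousP => u uab e e0; exists (e / (K + 1)).
    by rewrite divr_gt0// ltr_wpDl.
  move=> t tab; rewrite ltr_pdivlMr ?ltr_wpDl// => ut.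
  apply: le_lt_trans (cL _ _ uab tab) (le_lt_trans _ ut).
  by rewrite mulrC ler_wpM2l// lerDl.
move=> s; elim: s a ab cL {cA} => [|t s IH] a ab cL abs.
  by rewrite /= mulr_ge0// subr_ge0.
have ts := itv_partition_cons abs.
have at_ : a < t by case: abs => /= /andP[].
have tb := itv_partition_le ts.
have := IH t tb _ ts; have := cL a t; rewrite /= ltr0_norm; last lra.
move=> h1 h2.
have {}h1 : mdist (c a) (c t) <= K * - (a - t) by apply: h1;
  rewrite ?lexx ?(ltW at_).
have {}h2 : chain_length c t s <= K * (b - t).
  by apply: h2 => u v uP vP; apply: cL; lra.
by have := lerD h1 h2; rewrite -mulrDr opprB (addrC (t - a)) subrKA.
Qed.

Lemma joins_refl A x : A x -> joins A x x 0.
Proof.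
move=> Ax; have := @joins_lipschitz A (cst x) 0 0 0; rewrite mul0r; apply => //.
by move=> s t _ _; rewrite mdistxx mul0r.
Qed.

Lemma joins_sym A x y l : joins A x y l -> joins A y x l.
Proof.
move=> [a [b [c [[ab /within_itv_continuousP cc cx cy cA] H]]]].
exists (- b), (- a), (c \o -%R); split.
  split; rewrite /= ?opprK ?lerN2//.
    apply/within_itv_continuousP => u uab e e0.
    have [|h h0 hP] := cc (- u) _ e e0; first by lra.
    exists h => // t tab ut; apply: hP; first by lra.
    by rewrite -opprD normrN.
  by move=> t; rewrite in_itv/= => tab; apply: cA; rewrite in_itv/=; lra.
move=> s sP; have [t [tP <-]] := chain_length_opp (c \o -%R) sP.
rewrite !opprK in tP *; rewrite (_ : _ \o _ = c); first exact: H.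
by apply/funext => u /=; rewrite opprK.
Qed.

Lemma joins_trans A x y z l l' :
  joins A x y l -> joins A y z l' -> joins A x z (l + l').
Proof.
move=> [a [m [c1 [[am cc1 c1x c1y c1A] H1]]]].
move=> [a' [b' [c2 [[ab' /within_itv_continuousP cc2 c2y c2z c2A] H2]]]].
pose h := a' - m; pose b := b' - h;
  pose c t := if t <= m then c1 t else c2 (t + h).
have mb : m <= b by rewrite /b /h; lra.
have cm2 : {in `[m, b], c =1 fun t => c2 (t + h)}.
  move=> t; rewrite in_itv/= /c => /andP[mt tb]; case: ifPn => // tm.
  have -> : t = m by apply/eqP; rewrite eq_le mt tm.
  by rewrite c1y /h (addrC m) subrK.
have cm1 : {in `[a, m], c =1 c1}.
  by move=> t; rewrite in_itv/= /c => /andP[_ ->].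
have am_in : a \in `[a, m] by rewrite in_itv/= lexx.
have bm_in : b \in `[m, b] by rewrite in_itv/= lexx mb.
exists a, b, c; split.
  split; first exact: le_trans mb.
  - have -> : [set` `[a, b]] = [set` `[a, m]] `|` [set` `[m, b]].
      apply/seteqP; split => t /=; rewrite !in_itv/=; first by lra.
      by case; lra.
    apply: withinU_continuous; try exact: interval_closed.
      by apply: subspace_eq_continuous cc1 => t /set_mem/cm1.
    apply/within_itv_continuousP => u uab e e0.
    have [|k k0 kP] := cc2 (u + h) _ e e0; first by rewrite /b /h in uab *; lra.
    exists k => // t tab ut; rewrite !cm2 ?in_itv//; apply: kP.
      by rewrite /b /h in tab *; lra.
    by rewrite opprD addrACA subrr addr0.
  - by rewrite cm1.
  - by rewrite cm2// /b subrK.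
  move=> t; rewrite in_itv/= => tab; have [tm|mt] := leP t m.
    by rewrite cm1 ?in_itv/=; [apply: c1A; rewrite in_itv/=|]; lra.
  rewrite cm2 ?in_itv/=; last lra.
  by apply: c2A; rewrite in_itv/=; rewrite /b /h in tab *; lra.
move=> s /(chain_length_split c (m := m)) [|s1 [s2 [s1P s2P]]].
  by rewrite am mb.
move/le_trans; apply; rewrite (eq_chain_length s1P cm1) (eq_chain_length s2P
  cm2).
apply: lerD; first exact: H1.
have [t [tP <-]] := chain_length_shift c2 h s2P.
by rewrite /h (addrC m) subrK /b subrK in tP *; exact: H2.
Qed.

(** Partitions of the two halves concatenate to one of the whole; [l1] is the exact length of the
    first half and [l2] what remains of [l]. *)
Lemma joins_split A x y a b c l u : curve_in A x y a b c ->
  (forall s, itv_partition a b s -> chain_length c a s <= l) -> a <= u <= b ->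
  exists l1 l2, [/\ joins A x (c u) l1, joins A (c u) y l2 & l1 + l2 <= l].
Proof.
move=> [ab cc cx cy cA] H uab.
pose S := [set chain_length c a s | s in itv_partition a u].
have part v w : v <= w -> exists s, itv_partition v w s :> Prop.
  rewrite le_eqVlt => /predU1P[->|vw]; first by exists [::]; split => //=.
  by exists [:: w]; exact: itv_partition1.
have key s t : itv_partition a u s -> itv_partition u b t ->
    chain_length c a s + chain_length c u t <= l.
  move=> sP tP; have [_ /eqP su] := sP.
  by have := H _ (itv_partition_cat sP tP); rewrite chain_length_cat su.
have [/andP[au ub]] := uab.
have [s0 s0P] := part _ _ au; have [t0 t0P] := part _ _ ub.
have Ssup : has_sup S.
  split; first by exists (chain_length c a s0), s0.
  exists (l - chain_length c u t0) => _ [s sP <-].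
  by rewrite lerBrDr key.
exists (sup S), (l - sup S); split; last by rewrite addrC subrK.
- exists a, u, c; split.
    split => //; last by move=> t; rewrite in_itv/= => tP; apply: cA;
      rewrite in_itv/=; lra.
    by apply: continuous_subspaceW cc => t /=; rewrite !in_itv/=; lra.
  by move=> s sP; apply: sup_upper_bound => //; exists s.
exists u, b, c; split.
  split => //; last by move=> t; rewrite in_itv/= => tP; apply: cA;
    rewrite in_itv/=; lra.
  by apply: continuous_subspaceW cc => t /=; rewrite !in_itv/=; lra.
move=> t tP; rewrite lerBrDl -lerBrDr; apply: ge_sup; first by case: Ssup.
by move=> _ [s sP <-]; rewrite lerBrDr key.
Qed.

End Curves.

Section InteriorSpace.
Context {R : realType} {M : metricType R}.
Implicit Types (A : set M) (x y : M) (l : R).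

Definition inner_dist A x y : R := inf [set l | joins A x y l].

Lemma joins_ge0 A x y l : joins A x y l -> 0 <= l.
Proof. by move=> /joins_dist; apply: le_trans; exact: mdist_ge0. Qed.

Lemma inner_dist_le A x y l : joins A x y l -> inner_dist A x y <= l.
Proof.
by move=> xy; apply: ge_inf => //; exists 0 => k; exact: joins_ge0.
Qed.

Lemma inner_dist_adherent A x y e : (exists l, joins A x y l) -> 0 < e ->
  joins A x y (inner_dist A x y + e).
Proof.
move=> [l xy] e0.
have [|k xyk /ltW/joinsW] := @inf_adherent _ [set l | joins A x y l] _ e0.
  by split; [exists l|exists 0 => k; exact: joins_ge0].
exact.
Qed.

Lemma inner_dist_ge A x y : (exists l, joins A x y l) ->
  mdist x y <= inner_dist A x y.
Proof.
move=> xy; apply/ler_addgt0Pr => e e0.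
exact: joins_dist (inner_dist_adherent xy e0).
Qed.

Lemma inner_dist_sym A x y : inner_dist A x y = inner_dist A y x.
Proof.
by congr inf; apply/seteqP; split => l; exact: joins_sym.
Qed.

Lemma inner_dist_triangle A x y z : (exists l, joins A x y l) ->
  (exists l, joins A y z l) ->
  inner_dist A x z <= inner_dist A x y + inner_dist A y z.
Proof.
move=> xy yz; apply/ler_addgt0Pr => e e0.
have e2 : 0 < e / 2 by lra.
apply: le_trans (inner_dist_le (joins_trans (inner_dist_adherent xy e2)
  (inner_dist_adherent yz e2))) _; lra.
Qed.

Lemma inner_distxx A x : A x -> inner_dist A x x = 0.
Proof.
move=> /joins_refl xx; apply/eqP; rewrite eq_le inner_dist_le//=.
by have := @inner_dist_ge A x x; rewrite mdistxx; apply; exists 0.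
Qed.

Lemma interior_distE A x y : (exists l, joins A x y l) ->
  interior_dist A x y = (inner_dist A x y)%:E.
Proof.
move=> xy; apply/eqP; rewrite eq_le; apply/andP; split.
  apply/lee_addgt0Pr => e e0.
  have [a [b [c [cP H]]]] := inner_dist_adherent xy e0.
  apply: ereal_inf_le; exists (curve_length a b c); first by exists a, b, c.
  apply: ge_ereal_sup => _ [s sP <-]; rewrite -EFinD lee_fin polygonal_lengthE.
  exact: H.
apply: le_ereal_inf_tmp => _ [a [b [c [cP ->]]]].
have le_len s : itv_partition a b s ->
    ((chain_length c a s)%:E <= curve_length a b c)%E.
  by move=> sP; apply: ereal_sup_ubound; exists s => //;
    rewrite polygonal_lengthE.
case E : (curve_length a b c) => [l| |]; rewrite ?leey//.
  rewrite lee_fin; apply: inner_dist_le; exists a, b, c; split => // s /le_len.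
  by rewrite E lee_fin.
have [ab _ _ _ _] := cP.
have [s sP] : exists s, itv_partition a b s :> Prop.
  move: ab; rewrite le_eqVlt => /predU1P[->|ab]; first by exists [::];
    split => //=.
  by exists [:: b]; exact: itv_partition1.
by have := le_len _ sP; rewrite E leeNy_eq.
Qed.

Section Construction.
Context (A : set M).
Hypothesis A_joins : forall x y, A x -> A y -> exists l, joins A x y l.

(* The vacuous application keeps [A_joins], on which the metric depends, among
   the parameters of the type. *)
Definition inner_space : Type := (fun=> set_type A) A_joins.

HB.instance Definition _ := Choice.copy inner_space (set_type A).

Definition inner_space_val (p : inner_space) : M := set_val p.

Let val_joins (p q : inner_space) :
  exists l, joins A (inner_space_val p) (inner_space_val q) l.
Proof. by apply: A_joins; exact: set_valP. Qed.

Definition inner_space_dist (p q : inner_space) : R :=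
  inner_dist A (inner_space_val p) (inner_space_val q).

Let distxx p : inner_space_dist p p = 0.
Proof. by apply: inner_distxx; exact: set_valP. Qed.

Let dist_positivity p q : inner_space_dist p q = 0 -> p = q.
Proof.
move=> pq; apply/val_inj/(mdist_positivity)/eqP.
by rewrite eq_le mdist_ge0 andbT -pq; exact: inner_dist_ge.
Qed.

Let dist_sym p q : inner_space_dist p q = inner_space_dist q p.
Proof. exact: inner_dist_sym. Qed.

Let dist_triangle q p r :
  inner_space_dist p r <= inner_space_dist p q + inner_space_dist q r.
Proof. exact: inner_dist_triangle. Qed.

HB.instance Definition _ := isMetric.Build R inner_space
  distxx dist_positivity dist_sym dist_triangle.

Lemma inner_space_is_interior : is_interior_space A inner_space_val.
Proof.
split; last by move=> p q; rewrite interior_distE.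
split.
- by move=> p _; exact: set_valP.
- by move=> p q _ _; exact: val_inj.
- by move=> x Ax; exists (SigSub (mem_set Ax)).
Qed.

Lemma inner_space_dist_ge (p q : inner_space) :
  mdist (inner_space_val p) (inner_space_val q) <= mdist p q.
Proof. exact: inner_dist_ge. Qed.

Lemma inner_space_dist_le (p q : inner_space) l :
  joins A (inner_space_val p) (inner_space_val q) l -> mdist p q <= l.
Proof. exact: inner_dist_le. Qed.

Lemma inner_space_val_surj x : A x -> exists p, inner_space_val p = x.
Proof. by move=> Ax; exists (SigSub (mem_set Ax)). Qed.

Hypothesis A_top : forall p e, A p -> 0 < e -> exists2 h : R, 0 < h &
  forall q, A q -> mdist p q < h -> inner_dist A p q < e.

(** [A_top] makes the interior distance from [p] continuous along a nearly shortest curve, so it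
    takes the value [t] at some point. The first piece of the curve has length at least [t], which
    bounds the second. *)
Lemma inner_space_approx_between (p q : inner_space) (t e : R) :
  0 <= t <= mdist p q -> 0 < e ->
  exists w, mdist p w <= t + e /\ mdist w q <= mdist p q - t + e.
Proof.
move=> tpq e0; have [a [b [c [cP H]]]] := inner_dist_adherent (val_joins p q)
  e0.
have [ab /within_itv_continuousP cc cp cq cA] := cP.
pose f u := inner_dist A (inner_space_val p) (c u).
have Ac u : a <= u <= b -> A (c u) by move=> uab; apply: cA; rewrite in_itv.
have Ap : A (inner_space_val p) by exact: set_valP.
have f_cont : {within `[a, b], continuous f}.
  apply/(within_itv_continuousP (M := R^o)) => u uab d d0.
  have [h h0 hP] := A_top (Ac u uab) d0; have [k k0 kP] := cc u uab h h0.
  exists k => // v vab uv; apply: le_lt_trans (hP _ (Ac _ vab) (kP _ vab uv)).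
  have Au := Ac u uab; have Av := Ac v vab.
  rewrite /mdist/= distrC ler_distl /f.
  have := inner_dist_triangle (A_joins Ap Au) (A_joins Au Av).
  have := inner_dist_triangle (A_joins Ap Av) (A_joins Av Au).
  by rewrite (inner_dist_sym _ (c v)); lra.
have [|u uab fu] := @IVT _ f a b t ab f_cont.
  rewrite /f cp cq inner_distxx// ge_min le_max.
  by case/andP: tpq => -> tpq /=; apply/orP; right.
have [l1 [l2 [pu uq l12]]] := joins_split cP H uab.
have [w wu] := inner_space_val_surj (Ac u uab).
exists w; rewrite -wu in pu uq fu.
have -> : mdist p w = t by rewrite -fu /f -wu.
split; first by lra.
have := inner_dist_le pu; have := inner_space_dist_le uq.
have := fu; rewrite /f -wu => ->.
rewrite -[inner_dist A _ _]/(mdist p q) in l12; lra.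
Qed.

End Construction.

End InteriorSpace.

(** * Lower bound for the interior metric *)

Section QuasiUltrametricChain.
Context {R : realFieldType} {T : Type}.

(* Frink's chaining argument: cut the chain at the step where the partial sums
   pass half of the total. *)
Lemma quasi_ultrametric_chain (f : T -> T -> R) (p : nat -> T) (m n : nat) :
  (forall x y, 0 <= f x y) ->
  (forall x y w, f x w <= 2 * Num.max (f x y) (f y w)) ->
  (forall x y z w, f x w <= 2 * Num.max (f x y) (Num.max (f y z) (f z w))) ->
  f (p m) (p (m + n.+1)%N) <=
  2 * \sum_(m <= i < (m + n.+1)%N) f (p i) (p i.+1).
Proof.
move=> f0 f3 f4; elim/ltn_ind: n m => n IH m.
set W := \sum_(_ <= _ < _) _.
have sum0 a b : 0 <= \sum_(a <= i < b) f (p i) (p i.+1) by exact: sumr_ge0.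
have split3 k : (k <= n)%N -> W = \sum_(m <= i < (m + k)%N) f (p i) (p i.+1) +
    (f (p (m + k)%N) (p (m + k)%N.+1) +
    \sum_((m + k)%N.+1 <= i < (m + n.+1)%N) f (p i) (p i.+1)).
  move=> kn; rewrite /W (big_cat_nat (n := (m + k)%N))/= ?leq_addr//;
    last first.
    by rewrite leq_add2l ltnW.
  by rewrite (big_ltn (m := (m + k)%N))// ltn_add2l ltnS.
(* For the least such [k], the links before step [k] and those after it each sum to at most [W / 2],
   so induction bounds both end pieces by [W]. *)
pose P k := W / 2 <= \sum_(m <= i < (m + k.+1)%N) f (p i) (p i.+1).
have W0 : 0 <= W by exact: sum0.
have exP : exists k, P k by exists n; rewrite /P -/W; lra.
have [k Pk kmin] := ex_minnP exP.
have kn : (k <= n)%N by apply: kmin; rewrite /P -/W; lra.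
have WE := split3 k kn; set A := \sum_(m <= i < _) _ in WE.
set B := \sum_(_.+1 <= i < _) _ in WE; set F := f _ _ in WE.
have AF : \sum_(m <= i < (m + k.+1)%N) f (p i) (p i.+1) = A + F.
  by rewrite addnS big_nat_recr//= leq_addr.
have A0 : 0 <= A by exact: sum0.
have B0 : 0 <= B by exact: sum0.
have F0 : 0 <= F by exact: f0.
have BW : B <= W / 2 by move: Pk; rewrite /P AF; lra.
have left : (0 < k)%N -> f (p m) (p (m + k)%N) <= W.
  case: (k) kn kmin @A @B @F WE AF A0 B0 F0 BW {Pk} => // j jn jmin
    A B F WE _ _ _ _ _ _.
  apply: le_trans (IH j _ m) _; first exact: jn.
  have : A < W / 2.
    by rewrite ltNge; apply/negP => /jmin; rewrite ltnn.
  by rewrite -/A; lra.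
have right : (k < n)%N -> f (p (m + k)%N.+1) (p (m + n.+1)%N) <= W.
  move=> kn'.
  have e : (m + n.+1 = (m + k).+1 + (n - k.+1).+1)%N by lia.
  rewrite e; apply: le_trans (IH _ _ _) _; first by lia.
  by rewrite -e -/B; lra.
have FW : F <= W by rewrite WE; lra.
(* An end piece without links is outside the induction hypothesis; it is dropped, with [f3] in place
   of [f4]. *)
have [k0|k_gt0] := posnP k; have [kn'|nk] := ltnP k n.
- apply: le_trans (f3 _ (p (m + k)%N.+1) _) _;
    rewrite ler_pM2l// ge_max right//.
  by rewrite andbT; move: FW; rewrite /F k0 addn0.
- have e : n = 0%N by lia.
  by move: FW; rewrite /F k0 e addn0 addn1; lra.
- apply: le_trans (f4 _ (p (m + k)%N) (p (m + k)%N.+1) _) _.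
  by rewrite ler_pM2l// !ge_max left// right// andbT.
have e : k = n by lia.
apply: le_trans (f3 _ (p (m + k)%N) _) _; rewrite ler_pM2l// ge_max left//=.
by move: FW; rewrite /F e addnS.
Qed.

End QuasiUltrametricChain.

Section GeometricSums.
Context {R : realFieldType}.

Lemma geometric_sum_le (q : R) n : 0 <= q < 1 ->
  \sum_(0 <= i < n) q ^+ i <= (1 - q)^-1.
Proof.
move=> /andP[q0 q1]; rewrite -[leRHS]mul1r ler_pdivlMr ?subr_gt0//.
suff -> : (\sum_(0 <= i < n) q ^+ i) * (1 - q) = 1 - q ^+ n.
  by rewrite gerBl exprn_ge0.
elim: n => [|n IH]; first by rewrite big_geq// mul0r expr0 subrr.
by rewrite big_nat_recr//= mulrDl IH exprS; ring.
Qed.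

(** With truncated subtraction the exponent is the distance from [i] to [j]. *)
Lemma geometric_sum2_le (q : R) j n : 0 <= q < 1 -> (j <= n)%N ->
  \sum_(0 <= i < n) q ^+ ((j - i) + (i - j)) <= 2 * (1 - q)^-1.
Proof.
move=> q01 jn; rewrite (big_cat_nat (n := j))//= mulr_natl mulr2n; apply: lerD.
  have [q0 q1] := andP q01.
  apply: le_trans (geometric_sum_le j q01); rewrite big_nat_rev/= !big_nat.
  apply: ler_sum => i /andP[_ ij]; rewrite add0n.
  rewrite (_ : (_ + _)%N = i.+1); last by lia.
  by rewrite exprS ler_piMl ?exprn_ge0// ltW.
rewrite -{1}(add0n j) big_addn; apply: le_trans (geometric_sum_le (n - j) q01).
rewrite le_eqVlt; apply/orP; left; apply/eqP/eq_bigr => i _; congr (_ ^+ _);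
  lia.
Qed.

End GeometricSums.

Section LowerBound.
Context {R : realType}.

Let s2 : R := Num.sqrt 2.

Let s2_gt0 : 0 < s2.
Proof. by rewrite sqrtr_gt0. Qed.

Let natr_subD (i j : nat) : ((j - i) + (i - j))%:R = `|i%:R - j%:R| :> R.
Proof.
have [ij|/ltnW ji] := leqP i j.
  by rewrite (eqP ij) addn0 natrB// distrC ger0_norm// subr_ge0 ler_nat.
by rewrite (eqP ji) add0n natrB// ger0_norm// subr_ge0 ler_nat.
Qed.

Let norm_dist1_le (x y x' y' : R) : x - 1 <= x' <= x -> y - 1 <= y' <= y ->
  `|x - y| - 1 <= `|x' - y'|.
Proof.
move=> xx' yy'; rewrite lerBlDr ler_norml.
have := ler_norm (x' - y'); have := ler_norm (y' - x').
by rewrite (distrC y' x'); lra.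
Qed.

(* A chain of unit steps along a geodesic of [Y] has heights at least
   [m + (|i - j| - E) / (2 sqrt 2)] up to a constant, where [m] is the least
   height, reached at step [j], and [E] is the excess of the length over the
   cost of descending to [m] and climbing back.  The visual metric
   [exp (- eps (x . y))] summed along the chain is then a geometric sum, so that
   the Gromov product of the end points is at least [m - E / (2 sqrt 2)] up to a
   constant. *)
Lemma four_point_sqrt2_lower_bound (X : metricType R) (z : X) (k : R) :
  four_point z k -> exists C : R, forall (Y : metricType R) (f : Y -> X),
    geodesic_space Y ->
    (forall p q, mdist (f p) (f q) <= mdist p q) ->
    (forall p q, s2 * `|mdist (f p) z - mdist (f q) z| <= mdist p q) ->
    forall p q, s2 * mdist (f p) (f q) <= mdist p q + C.
Proof.
move=> fk; pose k' := Num.max k 1.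
have k'0 : 0 < k' by rewrite lt_max ltr01 orbT.
have {}fk : four_point z k' by apply: four_pointW fk; rewrite le_max lexx.
(* Chains of four points use the four-point inequality twice; this [eps] makes the resulting error
   [2 * k'] cost exactly the factor 2 that the chaining lemma allows. *)
pose eps : R := ln 2 / (2 * k').
have ln2 : 0 < ln 2 :> R by rewrite ln_gt0// ltr1n.
have eps0 : 0 < eps by rewrite divr_gt0// mulr_gt0.
have epsk : eps * (2 * k') = ln 2 by rewrite divfK// gt_eqF// mulr_gt0.
pose rho x y := expR (- eps * gromov_product z x y).
have rho_max (u v w : R) : Num.min u v - 2 * k' <= w ->
    expR (- eps * w) <= 2 * Num.max (expR (- eps * u)) (expR (- eps * v)).
  move=> uvw; have : expR (- eps * w) <= 2 * expR (- eps * Num.min u v).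
    rewrite -{1}[2](@lnK R) ?posrE// -expRD ler_expR -epsk.
    by rewrite mulNr mulNr lerNl opprD opprK addrC -mulrBr ler_pM2l.
  move/le_trans; apply; rewrite ler_pM2l// le_max.
  by case: (leP u v); rewrite lexx ?orbT.
have rho3 x y w : rho x w <= 2 * Num.max (rho x y) (rho y w).
  by apply: rho_max; have := fk x w y; lra.
have rho4 x y u w :
    rho x w <= 2 * Num.max (rho x y) (Num.max (rho y u) (rho u w)).
  have := fk x w y; have := fk y w u.
  set a := gromov_product z y u; set b := gromov_product z u w => h1 h2.
  have -> : Num.max (rho y u) (rho u w) = expR (- eps * Num.min a b).
    rewrite /rho -/a -/b; case: (leP a b) => ab.
      by apply/max_idPl; rewrite ler_expR ler_wnM2l// oppr_le0 ltW.
    by apply/max_idPr; rewrite ler_expR ler_wnM2l// ?oppr_le0 ltW.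
  apply: rho_max; rewrite lerBlDr ge_min; move: h2; rewrite lerBlDr ge_min.
  by case/orP => h2; apply/orP; [left|right]; lra.
pose c := eps / (2 * s2).
have c0 : 0 < c by rewrite divr_gt0// mulr_gt0.
have cE : c * (2 * s2) = eps by rewrite divfK// gt_eqF// mulr_gt0.
pose q := expR (- c).
have q01 : 0 <= q < 1 by rewrite expR_ge0 -expR0 ltr_expR oppr_lt0.
pose K := 2 * (2 * (1 - q)^-1).
have K0 : 0 < K by rewrite !mulr_gt0// invr_gt0 subr_gt0; case/andP: q01.
(* [ln K / c] comes from chaining and the geometric sum, [2 * s2] from the height 1 that a step may
   lose ([eps / c]), and [1] from rounding parameters to integers. *)
exists (ln K / c + 2 * s2 + 1) => Y f gY f1 f2 x y.
set D := mdist x y; have D0 : 0 <= D by exact: mdist_ge0.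
have [g gP] := geodesic_spaceP x y gY.
pose n := Num.truncn D.
have /andP[nD Dn] : n%:R <= D < n.+1%:R by apply: truncn_itv.
(* Unit steps, the last one cut off at [D]; up to the index [n.+1] the parameter lags behind the
   index by at most 1. *)
pose t (i : nat) := Num.min i%:R D.
have tD i : 0 <= t i <= D by rewrite le_min ler0n D0 ge_min lexx orbT.
pose P i := f (g (t i)); pose H i := mdist (P i) z.
have tP i : (i <= n.+1)%N -> i%:R - 1 <= t i <= i%:R.
  rewrite -(ler_nat R) -natr1 => iN; rewrite ge_min lexx andbT le_min.
  by apply/andP; split; lra.
have gt i j : mdist (g (t i)) (g (t j)) = `|t i - t j|.
  by rewrite (geodesic_path_dist gP).
have HH i j : s2 * `|H i - H j| <= `|t i - t j| by rewrite -gt; exact: f2.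
have t0 : t 0%N = 0 by apply/min_idPl.
have tn : t n.+1 = D by apply/min_idPr/ltW.
have [j _ jmin] := @arg_minP _ _ _ ord0 xpredT (fun i : 'I_n.+2 => H i) isT.
pose m := H j; pose a := H 0%N; pose b := H n.+1.
have Hm i : (i <= n.+1)%N -> m <= H i by move=> iN;
  exact: (jmin (Ordinal (iN : (i < n.+2)%N))).
pose E := D - s2 * (a - m) - s2 * (b - m).
(* Of the three pieces of the geodesic cut at [t i] and [t j], the outer two cost at least [s2]
   times their change of height, and [E] bounds what is left for the middle one. The factor [2 * s2]
   gives [E] the weight [c] in the exponent, for which the terms in [a], [b] and [m] cancel at the
   end. *)
have excess i : (i <= n.+1)%N -> `|t i - t j| - E <= 2 * s2 * (H i - m).
  move=> iN; have := Hm i iN; rewrite -(ler_pM2l s2_gt0) => mHi.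
  have hh i' j' : s2 * H i' - s2 * H j' <= `|t i' - t j'|.
    by apply: le_trans (HH i' j'); rewrite -mulrBr ler_pM2l// ler_norm.
  have := hh 0%N i; have := hh 0%N j; have := hh n.+1 i; have := hh n.+1 j.
  rewrite t0 tn !sub0r !normrN -/a -/b -/m.
  have /andP[ti0 tiD] := tD i; have /andP[tj0 tjD] := tD j.
  rewrite !(@ger0_norm _ (t _))// !(@ger0_norm _ (D - _)) ?subr_ge0//.
  rewrite /E mulrBr mulrBr -mulrA mulrBr.
  by have [ij|ji] := leP (t i) (t j);
    [rewrite ler0_norm|rewrite gtr0_norm]; lra.
have step i : (i <= n)%N -> rho (P i) (P i.+1) <=
    expR (- eps * (m - 1) + c * (1 + E)) * q ^+ ((j - i) + (i - j)).
  move=> iN; rewrite /q -expRM_natr -expRD ler_expR.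
  have jN : (j <= n.+1)%N by rewrite -ltnS.
  have ij : ((j - i) + (i - j))%:R - 1 <= `|t i - t j|.
    by rewrite natr_subD; apply: norm_dist1_le; apply: tP => //; exact: leqW.
  have g1 : H i - 1 <= gromov_product z (P i) (P i.+1).
    have d1 : mdist (P i) (P i.+1) <= 1.
      apply: le_trans (f1 _ _) _; rewrite gt.
      have /andP[? ?] := tD i; have /andP[? ?] := tD i.+1.
      rewrite ler_norml /t -natr1.
      by case: (leP i%:R D); case: (leP (i%:R + 1) D); lra.
    have := metric_triangle (P i) (P i.+1) z.
    by rewrite /gromov_product -/(H i) -/(H i.+1); lra.
  have ex := excess i (leqW iN).
  have {}ex : c * (((j - i) + (i - j))%:R - 1 - E) <= eps * (H i - m).
    by rewrite -cE -mulrA ler_pM2l//; lra.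
  have : eps * (H i - 1) <= eps * gromov_product z (P i) (P i.+1).
    by rewrite ler_pM2l.
  by rewrite /rho; lra.
have := @quasi_ultrametric_chain _ _ rho P 0 n
  (fun x y => expR_ge0 (- eps * gromov_product z x y)) rho3 rho4.
rewrite add0n => chain.
have {chain} : rho (P 0%N) (P n.+1) <= K * expR (- eps * (m - 1) + c * (1 + E)).
  apply: le_trans chain _; rewrite /K -mulrA ler_pM2l// mulrC.
  apply: le_trans (ler_wpM2l (expR_ge0 _)
    (geometric_sum2_le (j := j) (n := n.+1) q01 _)).
    by rewrite mulr_sumr !big_nat; apply: ler_sum => i /andP[_ iN]; exact: step.
  by rewrite -ltnS.
rewrite -{1}[K](@lnK R) ?posrE// -expRD ler_expR.
have -> : P 0%N = f x by rewrite /P t0; case: gP => ->.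
have -> : P n.+1 = f y by rewrite /P tn; case: gP => _ ->.
have aE : a = mdist (f x) z by rewrite /a /H /P t0; case: gP => ->.
have bE : b = mdist (f y) z by rewrite /b /H /P tn; case: gP => _ ->.
rewrite -cE /gromov_product -aE -bE; set d := mdist (f x) (f y) => h.
have : c * (s2 * d) <= c * (D + (ln K / c + 2 * s2 + 1)).
  have lnE : ln K = c * (ln K / c) by rewrite mulrC divfK// gt_eqF.
  by move: h; rewrite {1}lnE /E; lra.
by rewrite ler_pM2l.
Qed.

End LowerBound.

(** * The hyperbolic product *)

Section HyperbolicProductPaths.
Context {R : realType}.

Let s2 : R := Num.sqrt 2.

Let s2_gt0 : 0 < s2.
Proof. by rewrite sqrtr_gt0. Qed.

Lemma eprod_mdist_le (M N : metricType R) (p q : eprod M N) (r : R) : 0 <= r ->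
  mdist p.1 q.1 <= r -> mdist p.2 q.2 <= r -> mdist p q <= s2 * r.
Proof.
move=> r0 p1 p2; rewrite -[r]ger0_norm// -sqrtr_sqr -sqrtrM//.
by apply: ler_wsqrtr; rewrite mulr_natl mulr2n lerD// ler_sqr ?nnegrE//
  mdist_ge0.
Qed.

Lemma eprod_mdist_ge1 (M N : metricType R) (p q : eprod M N) :
  mdist p.1 q.1 <= mdist p q.
Proof.
rewrite -[leLHS]ger0_norm ?mdist_ge0// -sqrtr_sqr.
by apply: ler_wsqrtr; rewrite lerDl sqr_ge0.
Qed.

Lemma eprod_mdist_ge2 (M N : metricType R) (p q : eprod M N) :
  mdist p.2 q.2 <= mdist p q.
Proof.
rewrite -[leLHS]ger0_norm ?mdist_ge0// -sqrtr_sqr.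
by apply: ler_wsqrtr; rewrite lerDr sqr_ge0.
Qed.

Lemma eprod_mdist_ge (M N : metricType R) (p q : eprod M N) (r : R) : 0 <= r ->
  r <= mdist p.1 q.1 -> r <= mdist p.2 q.2 -> s2 * r <= mdist p q.
Proof.
move=> r0 p1 p2; rewrite -[r]ger0_norm// -sqrtr_sqr -sqrtrM//.
apply: ler_wsqrtr; rewrite mulr_natl mulr2n.
by apply: lerD; rewrite ler_sqr ?nnegrE// mdist_ge0.
Qed.

Definition short_on (M : metricType R) (a b : R) (c : R -> M) : Prop :=
  forall s t : R, a <= s <= b -> a <= t <= b -> mdist (c s) (c t) <= `|s - t|.

Lemma short_onS (M : metricType R) (a b a' b' : R) (c : R -> M) :
  a <= a' -> b' <= b -> short_on a b c -> short_on a' b' c.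
Proof. by move=> aa' bb' cL s t sP tP; apply: cL; lra. Qed.

Lemma geodesic_path_short (M : metricType R) (x y : M) g :
  geodesic_path x y g -> short_on 0 (mdist x y) g.
Proof. by move=> gP s t sD tD; rewrite (geodesic_path_dist gP). Qed.

Lemma mdist_height (M : metricType R) (z x y : M) :
  `|mdist z x - mdist z y| <= mdist x y.
Proof.
rewrite ler_norml; have := metric_triangle z x y.
by have := metric_triangle z y x; rewrite (metric_sym y x); lra.
Qed.

(* The path in the second factor follows the geodesic [g], at the height of the
   path joining [u] to [v] in the first one. *)
Lemma companion_path (M N : metricType R) (z u v : M) (z' w : N) g (h K : R) :
  geodesic_space M -> mdist z u = h -> mdist z v = h -> mdist u v <= K ->
  geodesic_path z' w g -> h + K / 2 <= mdist z' w ->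
  exists c c', [/\ c 0 = u /\ c (mdist u v) = v,
    c' 0 = g h /\ c' (mdist u v) = g h,
    short_on 0 (mdist u v) c, short_on 0 (mdist u v) c' &
    forall t, 0 <= t <= mdist u v -> mdist z (c t) = mdist z' (c' t)].
Proof.
move=> gM zu zv uvK gP hw; have [c cP] := geodesic_spaceP u v gM.
have [c0 cD cL] := cP.
(* A path of length at most [K] with both ends at height [h] never rises above [h + K / 2], so [g]
   is long enough to follow it. *)
have height t : 0 <= t <= mdist u v -> 0 <= mdist z (c t) <= mdist z' w.
  move=> tD; rewrite mdist_ge0/=.
  have := metric_triangle z u (c t); have := metric_triangle z v (c t).
  rewrite (geodesic_path_distl cP)// (metric_sym v) (geodesic_path_distr cP)//.
  by rewrite zu zv; lra.
exists c, (fun t => g (mdist z (c t))); split => //.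
- by rewrite c0 cD zu zv.
- exact: geodesic_path_short.
- move=> s t sD tD; rewrite (geodesic_path_dist gP) ?height//.
  apply: le_trans (mdist_height _ _ _) _.
  exact: (geodesic_path_short cP).
- by move=> t tD; rewrite (geodesic_path_distl gP) ?height.
Qed.

Section Paths.
Context (X1 X2 : metricType R) (z1 : X1) (z2 : X2).
Hypotheses (gX1 : geodesic_space X1) (gX2 : geodesic_space X2).

Let A := hyperbolic_product z1 z2.

Lemma hyperbolic_productE (p : eprod X1 X2) :
  A p <-> mdist z1 p.1 = mdist z2 p.2.
Proof. by rewrite (metric_sym z1) (metric_sym z2). Qed.

(** The source of the factor [sqrt 2]: two coordinates of speed at most 1 move together. *)
Lemma joins_pair (c1 : R -> X1) (c2 : R -> X2) (a b : R) : a <= b ->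
  short_on a b c1 -> short_on a b c2 ->
  (forall t, a <= t <= b -> mdist z1 (c1 t) = mdist z2 (c2 t)) ->
  joins A ((c1 a, c2 a) : eprod X1 X2) ((c1 b, c2 b) : eprod X1 X2)
    (s2 * (b - a)).
Proof.
move=> ab c1L c2L c12.
apply: (@joins_lipschitz _ _ _ (fun t => (c1 t, c2 t) : eprod X1 X2)).
- exact: ltW.
- by [].
- by move=> s t sP tP; apply: eprod_mdist_le;
    [exact: normr_ge0|exact: c1L|exact: c2L].
- by move=> t tP; apply/hyperbolic_productE; exact: c12.
Qed.

Lemma joins_vertical (p : eprod X1 X2) g1 g2 (h : R) : A p ->
  geodesic_path z1 p.1 g1 -> geodesic_path z2 p.2 g2 ->
  0 <= h <= mdist z1 p.1 ->
  joins A ((g1 h, g2 h) : eprod X1 X2) p (s2 * (mdist z1 p.1 - h)).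
Proof.
move=> /hyperbolic_productE Ap g1P g2P /andP[h0 hp].
have [_ e1 _] := g1P; have [_ e2 _] := g2P.
have g2L : short_on h (mdist z1 p.1) g2.
  by apply: (short_onS h0 _ (geodesic_path_short g2P)); rewrite Ap.
have := joins_pair hp (short_onS h0 (lexx _) (geodesic_path_short g1P)) g2L.
rewrite e1 (_ : g2 (mdist z1 p.1) = p.2); last by rewrite Ap.
rewrite -surjective_pairing; apply => t tP.
rewrite (geodesic_path_distl g1P); last by lra.
by rewrite (geodesic_path_distl g2P)// -Ap; lra.
Qed.

Lemma joins_connect (p q : eprod X1 X2) gp1 gp2 gq1 gq2 (h K : R) :
  A p -> A q -> geodesic_path z1 p.1 gp1 -> geodesic_path z2 p.2 gp2 ->
  geodesic_path z1 q.1 gq1 -> geodesic_path z2 q.2 gq2 -> 0 <= h -> 0 <= K ->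
  h + K / 2 <= mdist z1 p.1 -> h + K / 2 <= mdist z1 q.1 ->
  mdist (gp1 h) (gq1 h) <= K -> mdist (gp2 h) (gq2 h) <= K ->
  joins A p q (s2 * (mdist z1 p.1 + mdist z1 q.1 - 2 * h + 2 * K)).
Proof.
move=> Ap Aq gp1P gp2P gq1P gq2P h0 K0 hp hq k1 k2.
have [/hyperbolic_productE Ap' /hyperbolic_productE Aq'] := (Ap, Aq).
have h_p : 0 <= h <= mdist z1 p.1 by lra.
have h_q : 0 <= h <= mdist z1 q.1 by lra.
have Jp := joins_sym (joins_vertical Ap gp1P gp2P h_p).
have Jq := joins_vertical Aq gq1P gq2P h_q.
(* While the first coordinate crosses, the second moves along [gp2] and returns; then the second
   crosses and the first moves along [gq1]. *)
have J1 : joins A (gp1 h, gp2 h) (gq1 h, gp2 h) (s2 * K).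
  have hp2 : h + K / 2 <= mdist z2 p.2 by rewrite -Ap'.
  have [c [c' [[c0 cD] [c'0 c'D] cL c'L cc']]] := companion_path gX1
    (geodesic_path_distl gp1P h_p) (geodesic_path_distl gq1P h_q) k1 gp2P hp2.
  have := joins_pair (mdist_ge0 _ _) cL c'L cc'.
  by rewrite c0 cD c'0 c'D subr0; apply: joinsW; rewrite ler_pM2l.
have J2 : joins A (gq1 h, gp2 h) (gq1 h, gq2 h) (s2 * K).
  have h_p2 : 0 <= h <= mdist z2 p.2 by rewrite -Ap'.
  have h_q2 : 0 <= h <= mdist z2 q.2 by rewrite -Aq'.
  have [c [c' [[c0 cD] [c'0 c'D] cL c'L cc']]] := companion_path gX2
    (geodesic_path_distl gp2P h_p2) (geodesic_path_distl gq2P h_q2) k2 gq1P hq.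
  have := joins_pair (mdist_ge0 _ _) c'L cL (fun t tP => esym (cc' t tP)).
  by rewrite c0 cD c'0 c'D subr0; apply: joinsW; rewrite ler_pM2l.
have := joins_trans (joins_trans (joins_trans Jp J1) J2) Jq.
by apply: joinsW; rewrite -!mulrDr ler_pM2l//; lra.
Qed.

Lemma joins_through_base (p q : eprod X1 X2) : A p -> A q ->
  joins A p q (s2 * (mdist z1 p.1 + mdist z1 q.1)).
Proof.
move=> Ap Aq.
have [gp1 gp1P] := geodesic_spaceP z1 p.1 gX1.
have [gp2 gp2P] := geodesic_spaceP z2 p.2 gX2.
have [gq1 gq1P] := geodesic_spaceP z1 q.1 gX1.
have [gq2 gq2P] := geodesic_spaceP z2 q.2 gX2.
have := @joins_connect p q gp1 gp2 gq1 gq2 0 0 Ap Aq gp1P gp2P gq1P gq2P.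
rewrite mul0r mulr0 !addr0 subr0; apply; rewrite ?mdist_ge0//.
- by case: gp1P gq1P => -> _ _ [-> _ _]; rewrite mdistxx.
- by case: gp2P gq2P => -> _ _ [-> _ _]; rewrite mdistxx.
Qed.

Lemma hyperbolic_product_joins (p q : eprod X1 X2) : A p -> A q ->
  exists l, joins A p q l.
Proof. by move=> Ap Aq; eexists; exact: joins_through_base. Qed.

Hypotheses (pX1 : proper_space X1) (pX2 : proper_space X2).

Let ultra_geodesic (M : metricType R) (z x : M) (U : set_system R)
    (q : R -> M) (g : R -> R -> M) : proper_space M -> UltraFilter U ->
  (forall e, 0 < e -> \forall i \near U, mdist x (q i) < e) ->
  (forall i, geodesic_path z (q i) (g i)) ->
  exists2 gx, geodesic_path z x gx & forall h e, 0 <= h < mdist z x -> 0 < e ->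
    \forall i \near U, mdist (gx h) (g i h) < e.
Proof.
move=> pM UU qx gP.
(* The geodesic to [q i] may be shorter than [mdist z x], so it is prolonged by its end point. Below
   the height of [x] this has no effect eventually, hence the strict bound on [h] in the
   conclusion. *)
pose g' i t := g i (Num.min t (mdist z (q i))).
have minP i t : 0 <= t -> 0 <= Num.min t (mdist z (q i)) <= mdist z (q i).
  by move=> t0; rewrite le_min t0 mdist_ge0 ge_min lexx orbT.
have [|||gx gxP gxL] := @limit_geodesic _ _ pM _ U g' z x UU.
- have -> : g'^~ 0 = cst z.
    apply/funext => i; rewrite /g' (min_idPl (mdist_ge0 z (q i))).
    by case: (gP i).
  exact: cvg_cst.
- apply/cvgrPdist_lt => e e0; have e2 : 0 < e / 2 by lra.
  apply: filterS (qx _ e2) => i xi.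
  have := metric_triangle x (q i) (g' i (mdist z x)).
  rewrite (metric_sym (q i)) (geodesic_path_distr (gP i)) ?minP ?mdist_ge0//.
  have := mdist_height z x (q i); rewrite ler_norml.
  by case: (leP (mdist z x) (mdist z (q i))); lra.
- move=> e e0; apply: filterE => i s t;
    rewrite !in_itv/= => /andP[s0 _] /andP[t0 _].
  rewrite /g' (geodesic_path_dist (gP i)) ?minP//.
  apply: le_trans (_ : `|s - t| <= _); last by rewrite lerDl ltW.
  have [st|/ltW st] := leP s t; [rewrite !ler0_norm|rewrite !ger0_norm];
    by case: (leP s (mdist z (q i))); case: (leP t (mdist z (q i))); lra.
exists gx => // h e /andP[h0 hx] e0.
have : g' i h @[i --> U] --> gx h by apply: gxL; rewrite in_itv/= h0 ltW.
move/cvgrPdist_lt => /(_ e e0) near1.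
have d0 : 0 < mdist z x - h by rewrite subr_gt0.
apply: filterS2 near1 (qx _ d0) => i; rewrite /g' => + xi.
have -> // : Num.min h (mdist z (q i)) = h.
by apply/min_idPl; have := mdist_height z x (q i); rewrite ler_norml; lra.
Qed.

(* The interior metric induces the topology of [A], because the geodesics from
   the base point to points converging to [p] subconverge to a geodesic. *)
Lemma hyperbolic_product_top (p : eprod X1 X2) (e : R) : A p -> 0 < e ->
  exists2 r : R, 0 < r & forall q, A q -> mdist p q < r -> inner_dist A p q < e.
Proof.
move=> Ap e0; apply: contrapT => H.
have {}H r : exists q, 0 < r -> [/\ A q, mdist p q < r & e <= inner_dist A p q].
  apply: contrapT => H'; apply: H; have [r0|r0] := ltP 0 r; last first.
    by exfalso; apply: H'; exists p; rewrite ltNge r0.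
  exists r => // q Aq pq; rewrite ltNge; apply/negP => eq.
  by apply: H'; exists q.
have [q qP] := choice H.
have [U [UU U0]] : exists U : set_system R, UltraFilter U /\ 0^'+ `<=` U.
  exact: ultraFilterLemma.
have U_lt d : 0 < d -> \forall r \near U, 0 < r <= d.
  move=> d0; apply: U0; near=> r; apply/andP; split.
    by near: r; exact: nbhs_right_gt.
  by near: r; exact: nbhs_right_le.
have qp d : 0 < d -> \forall r \near U, mdist p (q r) < d.
  move=> d0; apply: filterS (U_lt _ d0) => r /andP[r0 rd].
  by have [_ pq _] := qP r r0; exact: lt_le_trans rd.
have [g1 g1P] := choice (fun r => geodesic_spaceP z1 (q r).1 gX1).
have [g2 g2P] := choice (fun r => geodesic_spaceP z2 (q r).2 gX2).
have [|gp1 gp1P lim1] := ultra_geodesic (x := p.1) pX1 UU _ g1P.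
  move=> d /qp; apply: filterS => r.
  by apply: le_lt_trans; exact: eprod_mdist_ge1.
have [|gp2 gp2P lim2] := ultra_geodesic (x := p.2) pX2 UU _ g2P.
  move=> d /qp; apply: filterS => r.
  by apply: le_lt_trans; exact: eprod_mdist_ge2.
(* Crossing with [K = eta] at [2 * eta] below the height of [p] costs at most [7 * eta] times [s2]:
   [eta] for the difference of heights, [4 * eta] for descent and ascent, [2 * eta] for the two
   crossings. *)
pose eta := e / (8 * s2); have eta0 : 0 < eta by rewrite divr_gt0// mulr_gt0.
have etaE : s2 * (8 * eta) = e by rewrite /eta; field; rewrite gt_eqF.
have [/hyperbolic_productE Ap'] := Ap.
pose L := mdist z1 p.1.
suff /filter_ex[r [r0 Jr]] : \forall r \near U, 0 < r /\
    joins A p (q r) (s2 * (7 * eta)).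
  have [_ _] := qP r r0; apply/negP; rewrite -ltNge.
  apply: le_lt_trans (inner_dist_le Jr) _.
  by rewrite -etaE ltr_pM2l//; lra.
have heightq r : mdist p (q r) < eta -> L - eta < mdist z1 (q r).1 < L + eta.
  move=> pq; have := mdist_height z1 p.1 (q r).1; rewrite ler_norml -/L.
  by have := eprod_mdist_ge1 p (q r); lra.
have [Leta|Leta] := ltP L (2 * eta).
  apply: filterS2 (U_lt _ eta0) (qp _ eta0) => r /andP[r0 _] pq; split => //.
  have [Aq _ _] := qP r r0; apply: joinsW (joins_through_base Ap Aq).
  by rewrite ler_pM2l// -/L; have := heightq r pq; lra.
have hL : 0 <= L - 2 * eta < mdist z1 p.1 by rewrite -/L; lra.
have hL2 : 0 <= L - 2 * eta < mdist z2 p.2 by rewrite -Ap'.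
apply: filterS2 (filterI (U_lt _ eta0) (qp _ eta0))
  (filterI (lim1 _ _ hL eta0) (lim2 _ _ hL2 eta0)).
move=> r [/andP[r0 _] pq] [l1 l2]; split => //.
have [Aq _ _] := qP r r0; have hq := heightq r pq.
apply: joinsW (joins_connect (h := L - 2 * eta) (K := eta) Ap Aq gp1P gp2P
  (g1P r) (g2P r) _ _ _ _ (ltW l1) (ltW l2)).
- by rewrite ler_pM2l// -/L; lra.
- by lra.
- by lra.
- by rewrite -/L; lra.
- by lra.
Unshelve. all: by end_near. Qed.

End Paths.

End HyperbolicProductPaths.

Section HyperbolicProductSpace.
Context {R : realType} (X1 X2 : metricType R) (z1 : X1) (z2 : X2).
Hypotheses (gX1 : geodesic_space X1) (gX2 : geodesic_space X2).
Hypotheses (pX1 : proper_space X1) (pX2 : proper_space X2).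

Let s2 : R := Num.sqrt 2.

Let s2_gt0 : 0 < s2.
Proof. by rewrite sqrtr_gt0. Qed.

Let A := hyperbolic_product z1 z2.

Definition hproduct : metricType R :=
  inner_space (hyperbolic_product_joins (z1 := z1) (z2 := z2) gX1 gX2).

Definition hfst (p : hproduct) : X1 := (inner_space_val p).1.
Definition hsnd (p : hproduct) : X2 := (inner_space_val p).2.

Lemma hproduct_height (p : hproduct) : mdist z1 (hfst p) = mdist z2 (hsnd p).
Proof. by apply/hyperbolic_productE; exact: set_valP. Qed.

Lemma hproduct_surj (x1 : X1) (x2 : X2) : mdist z1 x1 = mdist z2 x2 ->
  exists p : hproduct, hfst p = x1 /\ hsnd p = x2.
Proof.
move=> x12; have [|p pE] := @inner_space_val_surj _ _ _
  (hyperbolic_product_joins (z1 := z1) (z2 := z2) gX1 gX2)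
  ((x1, x2) : eprod X1 X2).
  exact/hyperbolic_productE.
by exists p; rewrite /hfst /hsnd pE.
Qed.

Lemma hfst_le (p q : hproduct) : mdist (hfst p) (hfst q) <= mdist p q.
Proof. exact: le_trans (eprod_mdist_ge1 _ _) (inner_space_dist_ge _ _). Qed.

Lemma hsnd_le (p q : hproduct) : mdist (hsnd p) (hsnd q) <= mdist p q.
Proof. exact: le_trans (eprod_mdist_ge2 _ _) (inner_space_dist_ge _ _). Qed.

Lemma hproduct_height_le (p q : hproduct) :
  s2 * `|mdist z1 (hfst p) - mdist z1 (hfst q)| <= mdist p q.
Proof.
apply: le_trans (inner_space_dist_ge _ _); apply: eprod_mdist_ge => //.
  exact: mdist_height.
by rewrite !hproduct_height; exact: mdist_height.
Qed.

(** Both coordinates converge along a bounded ultrafilter and equality of heights passes to the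
    limit. [hyperbolic_product_top] then turns coordinatewise convergence into convergence for the
    interior metric. *)
Lemma hproduct_proper : proper_space hproduct.
Proof.
move=> x r; rewrite compact_ultra => U UU Ur.
have U1 : \forall y \near U, mdist (hfst x) (hfst y) <= r.
  by apply: filterS Ur => y; apply: le_trans; exact: hfst_le.
have U2 : \forall y \near U, mdist (hsnd x) (hsnd y) <= r.
  by apply: filterS Ur => y; apply: le_trans; exact: hsnd_le.
have [p1 /cvgrPdist_lt p1P] := proper_ultra_cvg pX1 UU U1.
have [p2 /cvgrPdist_lt p2P] := proper_ultra_cvg pX2 UU U2.
have [|p [pE1 pE2]] := @hproduct_surj p1 p2.
  apply/eqP; rewrite -subr_eq0 -normr_le0; apply/ler_addgt0Pr => e e0.
  have e2 : 0 < e / 2 by lra.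
  have [y [y1 y2]] := filter_ex (filterI (p1P _ e2) (p2P _ e2)).
  have := mdist_height z1 p1 (hfst y); have := mdist_height z2 p2 (hsnd y).
  by rewrite add0r hproduct_height !ler_norml; move: y1 y2 => /=; lra.
have pU : U --> p.
  apply/fcvgrPdist_lt => e e0.
  have [h h0 hP] := hyperbolic_product_top gX1 gX2 pX1 pX2 (set_valP p) e0.
  have k0 : 0 < h / (2 * s2) by rewrite divr_gt0// mulr_gt0.
  apply: filterS2 (p1P _ k0) (p2P _ k0) => y; rewrite -pE1 -pE2 => y1 y2.
  apply: hP; first exact: set_valP.
  apply: le_lt_trans (eprod_mdist_le (ltW k0) (ltW y1) (ltW y2)) _.
  have -> : Num.sqrt 2 * (h / (2 * s2)) = h / 2.
    by rewrite -/s2; field; rewrite gt_eqF.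
  by lra.
exists p; split => //=; apply/ler_addgt0Pr => e e0.
have [y [xy py]] := filter_ex (filterI Ur ((fcvgrPdist_lt p).1 pU _ e0)).
have := metric_triangle x y p; rewrite (metric_sym y p); move: xy py => /=; lra.
Qed.

Lemma hproduct_geodesic : geodesic_space hproduct.
Proof.
apply: (proper_approx_between_geodesic hproduct_proper) => x y t e.
by apply: inner_space_approx_between => p d; exact: hyperbolic_product_top.
Qed.

Section Comparison.
Context (k1 k2 : R).
Hypotheses (fX1 : four_point z1 k1) (fX2 : four_point z2 k2).

Let hproduct_dist_le : exists C : R, forall p q : hproduct,
  mdist p q <=
  s2 * Num.max (mdist (hfst p) (hfst q)) (mdist (hsnd p) (hsnd q)) + C.
Proof.
pose k := Num.max 0 (Num.max k1 k2).
have k0 : 0 <= k by rewrite le_max lexx.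
have f1 : four_point z1 k by apply: four_pointW fX1; rewrite !le_max lexx !orbT.
have f2 : four_point z2 k by apply: four_pointW fX2; rewrite !le_max lexx !orbT.
pose K := 4 * k; exists (s2 * (4 * K)) => p q; rewrite -mulrDr.
set D := Num.max _ _.
have [gp1 gp1P] := geodesic_spaceP z1 (hfst p) gX1.
have [gp2 gp2P] := geodesic_spaceP z2 (hsnd p) gX2.
have [gq1 gq1P] := geodesic_spaceP z1 (hfst q) gX1.
have [gq2 gq2P] := geodesic_spaceP z2 (hsnd q) gX2.
pose a := mdist z1 (hfst p); pose b := mdist z1 (hfst q).
(* The smaller of the two Gromov products, as the heights agree. At the height [m - K] both pairs of
   geodesics are [K]-close and the detour has length [s2 * (D + 4 * K)]; when [m < K] the path
   through the base point is short enough. *)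
pose m := (a + b - D) / 2.
have m1 : m <= gromov_product z1 (hfst p) (hfst q).
  rewrite /m /a /b /gromov_product !(metric_sym z1).
  have : mdist (hfst p) (hfst q) <= D by rewrite le_max lexx.
  by lra.
have m2 : m <= gromov_product z2 (hsnd p) (hsnd q).
  rewrite /m /a /b /gromov_product !hproduct_height !(metric_sym z2).
  have : mdist (hsnd p) (hsnd q) <= D by rewrite le_max lexx orbT.
  by lra.
have [mK|mK] := leP K m; last first.
  apply: le_trans (inner_space_dist_le (joins_through_base gX1 gX2 (set_valP p)
    (set_valP q))) _.
  rewrite ler_pM2l//; rewrite -[mdist z1 _]/a -[X in _ + X]/b.
  have K0 : 0 <= K by rewrite mulr_ge0.
  by rewrite /m in mK; lra.
have ma : m <= a.
  by apply: le_trans m1 _; rewrite /a (metric_sym z1) gromov_product_le.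
have mb : m <= b.
  rewrite /b (metric_sym z1) gromov_productC in m1 *.
  exact: le_trans m1 (gromov_product_le _ _ _).
have K0 : 0 <= K by rewrite mulr_ge0.
have h0 : 0 <= m - K by lra.
have fellow (X : metricType R) (z x y : X) g g' : four_point z k ->
    geodesic_path z x g -> geodesic_path z y g' -> m <= gromov_product z x y ->
    mdist (g (m - K)) (g' (m - K)) <= K.
  move=> fz gP g'P mxy; apply: (geodesic_fellow_travel fz) gP g'P _ => //.
  by rewrite h0/=; lra.
have Jpq := joins_connect gX1 gX2 (set_valP p) (set_valP q)
  gp1P gp2P gq1P gq2P h0 K0.
apply: le_trans (inner_space_dist_le (Jpq _ _ _ _)) _.
- by rewrite -[mdist z1 _]/a; lra.
- by rewrite -[mdist z1 _]/b; lra.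
- exact: fellow f1 gp1P gq1P m1.
- exact: fellow f2 gp2P gq2P m2.
rewrite ler_pM2l//; rewrite -[mdist z1 _]/a -[X in _ + X - _]/b.
by rewrite /m; lra.
Qed.

Lemma hproduct_dist_comparison : exists C : R, forall p q : hproduct,
  `|mdist p q -
    s2 * Num.max (mdist (hfst p) (hfst q)) (mdist (hsnd p) (hsnd q))|
  <= C.
Proof.
have [C0 C0P] := hproduct_dist_le.
have [C1 C1P] := four_point_sqrt2_lower_bound fX1.
have [C2 C2P] := four_point_sqrt2_lower_bound fX2.
exists (Num.max C0 (Num.max C1 C2)) => p q; rewrite ler_norml.
have h1 : s2 * mdist (hfst p) (hfst q) <= mdist p q + C1.
  apply: (C1P _ _ hproduct_geodesic hfst_le _ p q) => p' q'.
  by rewrite !(metric_sym _ z1) hproduct_height_le.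
have h2 : s2 * mdist (hsnd p) (hsnd q) <= mdist p q + C2.
  apply: (C2P _ _ hproduct_geodesic hsnd_le _ p q) => p' q'.
  by rewrite !(metric_sym _ z2) -!hproduct_height hproduct_height_le.
have := C0P p q; set D := Num.max (mdist _ _) _; set C := Num.max _ _.
have c0 : C0 <= C by rewrite le_max lexx.
have c1 : C1 <= C by rewrite !le_max lexx orbT.
have c2 : C2 <= C by rewrite !le_max lexx !orbT.
have : s2 * D <= mdist p q + C.
  rewrite /D; case: (leP (mdist (hfst p) (hfst q)) (mdist (hsnd p) (hsnd q)))
    => _.
    by lra.
  by lra.
by lra.
Qed.

Let min_half_sub (c u v : R) :
  Num.min ((c - u) / 2) ((c - v) / 2) = (c - Num.max u v) / 2.
Proof. by case: (leP u v) => uv; [apply/min_idPr|apply/min_idPl]; lra. Qed.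

Let hproduct_base : exists o : hproduct, [/\ hfst o = z1, hsnd o = z2 &
  forall p : hproduct, mdist p o = s2 * mdist (hfst p) z1].
Proof.
have [|o [oz1 oz2]] := @hproduct_surj z1 z2; first by rewrite !mdistxx.
exists o; split => // p; apply/eqP; rewrite eq_le; apply/andP; split.
  apply: le_trans (inner_space_dist_le (joins_through_base gX1 gX2 (set_valP p)
    (set_valP o))) _.
  by rewrite -[(inner_space_val o).1]/(hfst o) oz1 mdistxx addr0 metric_sym.
have := hproduct_height_le p o.
by rewrite oz1 mdistxx subr0 ger0_norm ?mdist_ge0// metric_sym.
Qed.

(** The base points are arbitrary and [b] need not lie over [b1] and [b2]: moving each of them to
    [o], [z1], [z2] changes its Gromov products by a bounded amount. *)
Lemma hproduct_gromov_comparison (b1 : X1) (b2 : X2) (b : hproduct) :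
  exists C : R, forall p q : hproduct,
  `|gromov_product b p q - s2 * Num.min (gromov_product b1 (hfst p) (hfst q))
    (gromov_product b2 (hsnd p) (hsnd q))| <= C.
Proof.
have [ o [oz1 oz2 oP]] := hproduct_base.
have [C CP] := hproduct_dist_comparison.
exists (mdist b o + C / 2 + s2 * (mdist b1 z1 + mdist b2 z2)) => p q.
have := gromov_product_base b o p q; have := CP p q.
have := gromov_product_base b1 z1 (hfst p) (hfst q).
have := gromov_product_base b2 z2 (hsnd p) (hsnd q).
set u1 := gromov_product b1 _ _; set u2 := gromov_product b2 _ _.
set v1 := gromov_product z1 _ _; set v2 := gromov_product z2 _ _ => h2 h1 hC.
have -> : gromov_product o p q = s2 * Num.min v1 v2 -
    (mdist p q -
    s2 * Num.max (mdist (hfst p) (hfst q)) (mdist (hsnd p) (hsnd q))) / 2.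
  have -> : s2 * Num.min v1 v2 = s2 * (mdist (hfst p) z1 + mdist (hfst q) z1 -
      Num.max (mdist (hfst p) (hfst q)) (mdist (hsnd p) (hsnd q))) / 2.
    rewrite -mulrA; congr (_ * _); rewrite /v1 /v2 /gromov_product.
    rewrite !(metric_sym _ z1) !(metric_sym _ z2) -!hproduct_height.
    exact: min_half_sub.
  by rewrite /gromov_product !oP; field.
set e := mdist p q - _ in hC *.
have : `|s2 * Num.min v1 v2 - s2 * Num.min u1 u2| <=
    s2 * (mdist b1 z1 + mdist b2 z2).
  rewrite -mulrBr normrM (gtr0_norm s2_gt0) ler_pM2l//.
  have := mdist_ge0 b1 z1; have := mdist_ge0 b2 z2; move: h1 h2.
  rewrite !ler_norml.
  by case: (leP v1 v2); case: (leP u1 u2); lra.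
by move: hC; rewrite !ler_norml; lra.
Qed.

End Comparison.

End HyperbolicProductSpace.

Arguments hfst {R X1 X2 z1 z2 gX1 gX2} p.
Arguments hsnd {R X1 X2 z1 z2 gX1 gX2} p.

(** * Boundaries at infinity *)

Section BoundaryTheory.
Context {R : realType} {M : metricType R}.
Implicit Types (z b : M) (x y w : nat -> M).

Lemma gromov_liminf_geP z x y r : (r%:E <= gromov_liminf z x y)%E <->
  forall e, 0 < e -> exists N, forall k l, (N <= k)%N -> (N <= l)%N ->
    r - e <= gromov_product z (x k) (y l).
Proof.
rewrite /gromov_liminf limf_einfE; split=> [rxy e e0|H].
  have : ((r - e)%:E < ereal_sup [set ereal_inf [set
      (gromov_product z (x kl.1) (y kl.2))%:E | kl in V] |
      V in filter_prod \oo \oo])%E.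
    by apply: lt_le_trans rxy; rewrite lte_fin; lra.
  move=> /ereal_sup_gt[_ [V [[P Q] [/= [N _ NP] [N' _ NQ]] PQV] <-] rV].
  exists (maxn N N') => k l; rewrite !geq_max => /andP[Nk _] /andP[_ Nl].
  rewrite -lee_fin; apply: le_trans (ltW rV) _; apply: ereal_inf_lbound.
  by exists (k, l) => //; apply: PQV; split; [exact: NP|exact: NQ].
apply/lee_subgt0Pr => e e0; have [N NP] := H e e0.
pose V := [set kl : nat * nat | (N <= kl.1)%N /\ (N <= kl.2)%N].
apply: ereal_sup_ge; exists (ereal_inf [set
    (gromov_product z (x kl.1) (y kl.2))%:E | kl in V]).
  exists V => //; exists ([set k | (N <= k)%N], [set k | (N <= k)%N]) => //=.
  by split; exists N.
apply: le_ereal_inf_tmp => _ [[k l] [/= Nk Nl] <-].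
by rewrite -EFinB lee_fin NP.
Qed.

Lemma equiv_inftyP z x y : equiv_infty z x y <->
  forall r, exists N, forall k l, (N <= k)%N -> (N <= l)%N ->
    r <= gromov_product z (x k) (y l).
Proof.
rewrite /equiv_infty; split=> [xy r|H].
  have : ((r + 1)%:E <= gromov_liminf z x y)%E by rewrite xy leey.
  move=> /gromov_liminf_geP/(_ _ ltr01)[N NP]; exists N => k l Nk Nl.
  by have := NP k l Nk Nl; rewrite addrK.
apply/eqyP => r r0; apply/gromov_liminf_geP => e e0.
have [N NP] := H r; exists N => k l Nk Nl.
by apply: le_trans (NP k l Nk Nl); rewrite gerBl ltW.
Qed.

Lemma equiv_infty_sym z x y : equiv_infty z x y -> equiv_infty z y x.
Proof.
move=> /equiv_inftyP H; apply/equiv_inftyP => r; have [N NP] := H r.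
by exists N => k l Nk Nl; rewrite gromov_productC NP.
Qed.

Lemma equiv_infty_base z b x y : equiv_infty z x y -> equiv_infty b x y.
Proof.
move=> /equiv_inftyP H; apply/equiv_inftyP => r.
have [N NP] := H (r + mdist b z); exists N => k l Nk Nl.
by have := gromov_product_base b z (x k) (y l); rewrite ler_norml;
  have := NP k l Nk Nl; lra.
Qed.

Section FourPoint.
Context {z : M} {K : R}.
Hypothesis fz : four_point z K.

Lemma equiv_infty_trans y x w :
  equiv_infty z x y -> equiv_infty z y w -> equiv_infty z x w.
Proof.
move=> /equiv_inftyP xy /equiv_inftyP yw; apply/equiv_inftyP => r.
have [N NP] := xy (r + K); have [N' NP'] := yw (r + K).
exists (maxn N N') => k l; rewrite !geq_max => /andP[Nk _] /andP[_ Nl].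
apply: le_trans (fz _ _ (y (maxn N N'))); rewrite lerBrDr le_min.
by rewrite NP ?NP'// ?leq_maxl ?leq_maxr.
Qed.

Lemma equiv_infty_cvgr x y : equiv_infty z x y -> cvg_infty z y.
Proof. by move=> xy; exact: equiv_infty_trans (equiv_infty_sym xy) xy. Qed.

(** Products of equivalent sequences are eventually large, so replacing one sequence costs a single
    four-point error [K]. *)
Lemma gromov_liminf_equiv x x' y y' (r : R) : equiv_infty z x x' ->
  equiv_infty z y y' -> (r%:E <= gromov_liminf z x y)%E ->
  ((r - 2 * K)%:E <= gromov_liminf z x' y')%E.
Proof.
move=> /equiv_infty_sym/equiv_inftyP xx' /equiv_inftyP yy' /gromov_liminf_geP
  xy.
apply/gromov_liminf_geP => e e0.
have [N NP] := xy e e0; have [N1 N1P] := xx' (r - K); have [N2 N2P] := yy' r.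
exists (maxn N (maxn N1 N2)) => k l; rewrite !geq_max.
move=> /andP[Nk /andP[N1k N2k]] /andP[Nl /andP[N1l N2l]].
have h1 := N1P k k N1k N1k; have h2 := N2P l l N2l N2l; have h := NP k l Nk Nl.
have := fz (x' k) (y' l) (x k); have := fz (x k) (y' l) (y l).
by rewrite !lerBlDr !ge_min => /orP[?|?] /orP[?|?]; lra.
Qed.

Implicit Types v u : boundary z.

Let boundary_valE v : exists2 y, set_val v = boundary_class z y & cvg_infty z y.
Proof. have [y yc yE] := set_valP v; exists y => //.
Qed.

Lemma boundary_rep_cvg v x : set_val v x -> cvg_infty z x.
Proof. by have [y -> _] := boundary_valE v; case. Qed.

Lemma boundary_repE v x y : set_val v x -> set_val v y <-> equiv_infty z x y.
Proof.
have [w -> wc] := boundary_valE v; move=> [xc wx]; split=> [[yc wy]|xy].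
  exact: equiv_infty_trans (equiv_infty_sym wx) wy.
by split; [exact: equiv_infty_cvgr xy|exact: equiv_infty_trans wx xy].
Qed.

Lemma boundary_rep v : exists x, set_val v x.
Proof. by have [x -> xc] := boundary_valE v; exists x; split. Qed.

Lemma boundary_rep_eq v u x y :
  set_val v x -> set_val u y -> equiv_infty z x y -> v = u.
Proof.
move=> vx uy xy; apply/val_inj/seteqP; split => w.
  move/(boundary_repE _ vx) => xw; apply/(boundary_repE _ uy).
  exact: equiv_infty_trans (equiv_infty_sym xy) xw.
move/(boundary_repE _ uy) => yw; apply/(boundary_repE _ vx).
exact: equiv_infty_trans xy yw.
Qed.

Lemma boundary_of_cvg x : cvg_infty z x -> exists v, set_val v x.
Proof.
move=> xc; have cls : boundary_classes z (boundary_class z x) by exists x.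
by exists (SigSub (mem_set cls)); split.
Qed.

(** Since the sets [boundary_nbhd] need not be open, the open set inside [W] consists of all points
    that have one of these sets contained in [W]. Its openness is an approximate triangle inequality
    on the boundary. *)
Lemma nbhs_boundaryP v (W : set (boundary z)) :
  nbhs v W <-> exists2 r : R, 0 < r & boundary_nbhd v r `<=` W.
Proof.
split=> [|[r r0 rW]].
  rewrite nbhsE => -[B [oB Bv] BW]; have [r r0 rB] := oB v Bv.
  by exists r => // u /rB/BW.
rewrite nbhsE.
exists [set u | exists2 s : R, 0 < s & boundary_nbhd u s `<=` W]; last first.
  move=> u [s s0]; apply; have [x ux] := boundary_rep u.
  by exists x, x; split => //; rewrite (boundary_rep_cvg ux) leey.
split; last by exists r.
(* From [x] to [w] one passes through two representatives [y], [y'] of the same point, hence two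
   four-point errors; the maximum with 1 keeps the radius positive. *)
move=> u [s s0 sW]; exists (Num.max 1 (s + 2 * `|K|));
  first by rewrite lt_max ltr01.
move=> t [x [y [ux ty xy]]]; exists (Num.max 1 (s + 2 * `|K|)).
  by rewrite lt_max ltr01.
move=> t' [y' [w [ty' t'w y'w]]]; apply: sW; exists x, w; split => //.
have yy' := (boundary_repE _ ty).1 ty'.
apply/gromov_liminf_geP => e e0.
have /gromov_liminf_geP/(_ e e0)[N NP] := xy.
have /gromov_liminf_geP/(_ e e0)[N' NP'] := y'w.
have /equiv_inftyP/(_ (s + 2 * `|K|))[N2 NP2] := yy'.
exists (maxn N (maxn N' N2)) => k l; rewrite !geq_max.
pose n := maxn N (maxn N' N2).
move=> /andP[Nk _] /andP[_ /andP[N'l _]].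
have Nn : (N <= n)%N by rewrite leq_maxl.
have N'n : (N' <= n)%N by rewrite /n maxnCA leq_maxl.
have N2n : (N2 <= n)%N by rewrite /n maxnA leq_maxr.
have le1 : s + 2 * `|K| <= Num.max 1 (s + 2 * `|K|) by rewrite le_max lexx orbT.
have := ler_norm K; have := normr_ge0 K.
have := NP k n Nk Nn; have := NP' n l N'n N'l; have := NP2 n n N2n N2n.
have := fz (x k) (w l) (y n); have := fz (y n) (w l) (y' n).
by rewrite !lerBlDr !ge_min => /orP[?|?] /orP[?|?]; lra.
Qed.

End FourPoint.

End BoundaryTheory.

Section BoundaryProduct.
Context {R : realType} (Y X1 X2 : metricType R) (b : Y) (b1 : X1) (b2 : X2).
Context (f1 : Y -> X1) (f2 : Y -> X2) (lam C k1 k2 : R).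
Hypotheses (lam_gt0 : 0 < lam) (fX1 : four_point b1 k1)
  (fX2 : four_point b2 k2).
Hypothesis comparison : forall p q, `|gromov_product b p q - lam *
  Num.min (gromov_product b1 (f1 p) (f1 q)) (gromov_product b2 (f2 p) (f2 q))|
  <= C.

(** The minimum of two Gromov products satisfies the inequality with the larger constant; scaling by
    [lam] and the error [C] on both sides give the constant. *)
Lemma comparison_four_point : exists2 k, 0 <= k & four_point b k.
Proof.
pose k := Num.max k1 k2; exists (2 * C + lam * `|k|).
  have C0 : 0 <= C by apply: le_trans (comparison b b).
  by rewrite addr_ge0// mulr_ge0// ltW.
move=> x y w.
have := comparison x y; have := comparison x w; have := comparison w y.
have := fX1 (f1 x) (f1 y) (f1 w); have := fX2 (f2 x) (f2 y) (f2 w).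
set u1 := gromov_product b1 _ _; set u2 := gromov_product b1 _ _.
set u3 := gromov_product b1 _ _; set v1 := gromov_product b2 _ _.
set v2 := gromov_product b2 _ _; set v3 := gromov_product b2 _ _ => h2 h1.
have : Num.min (Num.min u1 v1) (Num.min u2 v2) - `|k| <= Num.min u3 v3.
  have a1 : k1 <= `|k| by apply: le_trans (ler_norm _); rewrite le_max lexx.
  have a2 : k2 <= `|k| by apply: le_trans (ler_norm _);
    rewrite le_max lexx orbT.
  rewrite le_min; apply/andP; split.
    apply: le_trans h1; apply: lerB => //; rewrite le_min !ge_min !lexx /=.
    by rewrite ?orbT.
  apply: le_trans h2; apply: lerB => //; rewrite le_min !ge_min !lexx /=.
  by rewrite ?orbT.
rewrite -(ler_pM2l lam_gt0 (_ - _)) mulrBr minr_pMr ?(ltW lam_gt0)//.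
rewrite !ler_norml; set p := lam * _; set q := lam * _;
  set r := lam * Num.min u3 _.
rewrite !lerBlDr !ge_min => /orP[?|?] ? ? ?; apply/orP; [left|right]; lra.
Qed.

Let equivE x y : equiv_infty b x y <->
  equiv_infty b1 (f1 \o x) (f1 \o y) /\ equiv_infty b2 (f2 \o x) (f2 \o y).
Proof.
split=> [/equiv_inftyP xy|[/equiv_inftyP xy1 /equiv_inftyP xy2]].
  by split; apply/equiv_inftyP => r; have [N NP] := xy (lam * r + C);
    exists N => k l Nk Nl; have := NP k l Nk Nl; have := comparison (x k) (y l);
    rewrite ler_norml => /andP[_ h] h'; rewrite -(ler_pM2l lam_gt0);
    apply: le_trans (_ : lam * Num.min _ _ <= _); (try lra);
    rewrite ler_pM2l// ge_min lexx ?orbT.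
apply/equiv_inftyP => r; pose s := (r + C) / lam.
have sE : lam * s = r + C by rewrite mulrC divfK// gt_eqF.
have [N1 NP1] := xy1 s; have [N2 NP2] := xy2 s.
exists (maxn N1 N2) => k l; rewrite !geq_max => /andP[N1k N2k] /andP[N1l N2l].
have : s <= Num.min (gromov_product b1 (f1 (x k)) (f1 (y l)))
    (gromov_product b2 (f2 (x k)) (f2 (y l))) by rewrite le_min NP1 ?NP2.
rewrite -(ler_pM2l lam_gt0) sE.
by have := comparison (x k) (y l); rewrite ler_norml; lra.
Qed.

(** Pairs of sequences with different heights do not lift to [Y], so lifting is asked for only up to
    equivalence. *)
Hypothesis surjective_infty : forall x1 x2, cvg_infty b1 x1 ->
  cvg_infty b2 x2 -> exists y, equiv_infty b1 (f1 \o y) x1 /\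
    equiv_infty b2 (f2 \o y) x2.

Lemma boundary_product_homeomorphic :
  homeomorphic (boundary b) (boundary b1 * boundary b2)%type.
Proof.
have [k _ fY] := comparison_four_point.
have F_ex (v : boundary b) : exists w : boundary b1 * boundary b2,
    forall x, set_val v x -> set_val w.1 (f1 \o x) /\ set_val w.2 (f2 \o x).
  have [x vx] := boundary_rep v.
  have [c1 c2] := (equivE x x).1 (boundary_rep_cvg vx).
  have [w1 w1x] := boundary_of_cvg c1; have [w2 w2x] := boundary_of_cvg c2.
  exists (w1, w2) => y vy;
    have [] := (equivE x y).1 ((boundary_repE fY _ vx).1 vy).
  by move=> /(boundary_repE fX1 _ w1x) ? /(boundary_repE fX2 _ w2x).
have G_ex (w : boundary b1 * boundary b2) : exists v : boundary b, exists y,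
    [/\ set_val v y, set_val w.1 (f1 \o y) & set_val w.2 (f2 \o y)].
  have [x1 wx1] := boundary_rep w.1; have [x2 wx2] := boundary_rep w.2.
  have [y [/equiv_infty_sym y1 /equiv_infty_sym y2]] :=
    surjective_infty (boundary_rep_cvg wx1) (boundary_rep_cvg wx2).
  have [|v vy] := @boundary_of_cvg _ _ b y.
    apply/equivE; split; [exact: (equiv_infty_cvgr fX1 y1)|].
    exact: (equiv_infty_cvgr fX2 y2).
  by exists v, y; split => //; [apply/(boundary_repE fX1 _ wx1)|
    apply/(boundary_repE fX2 _ wx2)].
have [F FP] := choice F_ex; have [G GP] := choice G_ex.
exists F, G; split.
- move=> v; have [y [Gy y1 y2]] := GP (F v); have [x vx] := boundary_rep v.
  have [x1 x2] := FP v x vx; apply: (boundary_rep_eq fY Gy vx).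
  apply/equivE; split; [exact/(boundary_repE fX1 _ y1)|].
  exact/(boundary_repE fX2 _ y2).
- move=> w; have [y [Gy y1 y2]] := GP w; have [x1 x2] := FP _ y Gy.
  rewrite [RHS]surjective_pairing [LHS]surjective_pairing.
  congr (_, _); [apply: (boundary_rep_eq fX1 x1 y1)|
    apply: (boundary_rep_eq fX2 x2 y2)].
  + exact: boundary_rep_cvg y1.
  + exact: boundary_rep_cvg y2.
- move=> v W [[W1 W2] /= [/(nbhs_boundaryP fX1)[r1 r10 rW1]
    /(nbhs_boundaryP fX2)[r2 r20 rW2]] W12].
  apply/(nbhs_boundaryP fY); pose r := Num.max r1 r2.
  have r_gt0 : 0 < r by rewrite lt_max r10.
  (* Inverts the comparison: a product of at least [lam * r + C] in [Y] forces both factors to be at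
     least [r]. *)
  exists (Num.max 1 (lam * r + C)); first by rewrite lt_max ltr01.
  move=> u [x [y [vx uy xy]]].
  have [x1 x2] := FP v x vx; have [y1 y2] := FP u y uy.
  have {}xy e : 0 < e -> exists N, forall k l, (N <= k)%N -> (N <= l)%N ->
      r - e <= Num.min (gromov_product b1 (f1 (x k)) (f1 (y l)))
        (gromov_product b2 (f2 (x k)) (f2 (y l))).
    move=> e0; have /gromov_liminf_geP/(_ (lam * e))[|N NP] := xy.
      by rewrite mulr_gt0.
    exists N => i j Ni Nj; rewrite -(ler_pM2l lam_gt0) mulrBr.
    have := NP i j Ni Nj; have := comparison (x i) (y j).
    have : lam * r + C <= Num.max 1 (lam * r + C) by rewrite le_max lexx orbT.
    by rewrite ler_norml; lra.
  apply: W12; split; [apply: rW1|apply: rW2].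
    exists (f1 \o x), (f1 \o y); split => //; apply/gromov_liminf_geP => e /xy.
    move=> [N NP]; exists N => i j Ni Nj.
    have := NP i j Ni Nj; rewrite le_min => /andP[h _].
    by apply: le_trans h; rewrite lerB// le_max lexx.
  exists (f2 \o x), (f2 \o y); split => //; apply/gromov_liminf_geP => e /xy.
  move=> [N NP]; exists N => i j Ni Nj.
  have := NP i j Ni Nj; rewrite le_min => /andP[_ h].
  by apply: le_trans h; rewrite lerB// le_max lexx orbT.
move=> w W /(nbhs_boundaryP fY)[r r0 rW].
pose s := (r + C) / lam.
have sE : lam * s = r + C by rewrite mulrC divfK// gt_eqF.
(* The sequences witnessing the neighborhoods in the two factors need not lift together; exchanging
   them for the images of sequences in [Y] costs [2 * k1] and [2 * k2]. *)
pose s1 := Num.max 1 (s + 2 * k1); pose s2 := Num.max 1 (s + 2 * k2).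
exists ([set v | boundary_nbhd w.1 s1 v], [set v | boundary_nbhd w.2 s2 v]).
  split; [apply/(nbhs_boundaryP fX1); exists s1 => //|
    apply/(nbhs_boundaryP fX2); exists s2 => //]; by rewrite lt_max ltr01.
move=> u [[x1 [y1 [wx1 uy1 xy1]]] [x2 [y2 [wx2 uy2 xy2]]]].
apply: rW; have [x [Gx gx1 gx2]] := GP w; have [y [Gy gy1 gy2]] := GP u.
exists x, y; split => //.
have h1 := gromov_liminf_equiv fX1 ((boundary_repE fX1 _ wx1).1 gx1)
  ((boundary_repE fX1 _ uy1).1 gy1) xy1.
have h2 := gromov_liminf_equiv fX2 ((boundary_repE fX2 _ wx2).1 gx2)
  ((boundary_repE fX2 _ uy2).1 gy2) xy2.
apply/gromov_liminf_geP => e e0.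
have e'0 : 0 < e / lam by rewrite divr_gt0.
have eE : lam * (e / lam) = e by rewrite mulrC divfK// gt_eqF.
have /gromov_liminf_geP/(_ _ e'0)[N1 NP1] := h1.
have /gromov_liminf_geP/(_ _ e'0)[N2 NP2] := h2.
exists (maxn N1 N2) => i j; rewrite !geq_max => /andP[N1i N2i] /andP[N1j N2j].
have : s - e / lam <= Num.min (gromov_product b1 (f1 (x i)) (f1 (y j)))
    (gromov_product b2 (f2 (x i)) (f2 (y j))).
  rewrite le_min; apply/andP; split.
    apply: le_trans (NP1 i j N1i N1j); rewrite lerB// lerBrDr.
    by rewrite le_max lexx orbT.
  apply: le_trans (NP2 i j N2i N2j); rewrite lerB// lerBrDr.
  by rewrite le_max lexx orbT.
rewrite -(ler_pM2l lam_gt0) mulrBr sE eE.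
by have := comparison (x i) (y j); rewrite ler_norml; lra.
Qed.

End BoundaryProduct.

(** The geodesics to [x1 k] and [x2 k] are cut at the smaller of the two heights, which gives a
    point of the product. The Gromov product of the cut point with the end of its geodesic is
    exactly that height, which tends to infinity. *)
Lemma hproduct_surj_infty (R : realType) (X1 X2 : metricType R)
    (z1 b1 : X1) (z2 b2 : X2) (gX1 : geodesic_space X1)
    (gX2 : geodesic_space X2) (k1 k2 : R) :
  four_point z1 k1 -> four_point z2 k2 ->
  forall x1 x2, cvg_infty b1 x1 -> cvg_infty b2 x2 ->
  exists y : nat -> hproduct z1 z2 gX1 gX2,
    equiv_infty b1 (hfst \o y) x1 /\ equiv_infty b2 (hsnd \o y) x2.
Proof.
move=> f1 f2 x1 x2 /(equiv_infty_base z1) c1 /(equiv_infty_base z2) c2.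
have [g1 g1P] := choice (fun k => geodesic_spaceP z1 (x1 k) gX1).
have [g2 g2P] := choice (fun k => geodesic_spaceP z2 (x2 k) gX2).
pose m k := Num.min (mdist z1 (x1 k)) (mdist z2 (x2 k)).
have m1 k : 0 <= m k <= mdist z1 (x1 k).
  by rewrite le_min !mdist_ge0 ge_min lexx.
have m2 k : 0 <= m k <= mdist z2 (x2 k).
  by rewrite le_min !mdist_ge0 ge_min lexx orbT.
have /choice[y yP] k : exists y : hproduct z1 z2 gX1 gX2,
    hfst y = g1 k (m k) /\ hsnd y = g2 k (m k).
  apply: hproduct_surj.
  by rewrite (geodesic_path_distl (g1P k))// (geodesic_path_distl (g2P k)).
have m_infty r : exists N, forall k, (N <= k)%N -> r <= m k.
  have /equiv_inftyP/(_ r)[N1 NP1] := c1;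
    have /equiv_inftyP/(_ r)[N2 NP2] := c2.
  exists (maxn N1 N2) => k; rewrite geq_max => /andP[N1k N2k]; rewrite le_min.
  rewrite (le_trans (NP1 k k N1k N1k)) ?(le_trans (NP2 k k N2k N2k))//.
    by rewrite (metric_sym z2) gromov_product_le.
  by rewrite (metric_sym z1) gromov_product_le.
have follow (X : metricType R) (z : X) (k : R) x (g : nat -> R -> X) :
    four_point z k -> (forall i, geodesic_path z (x i) (g i)) ->
    (forall i, 0 <= m i <= mdist z (x i)) -> cvg_infty z x ->
    equiv_infty z (fun i => g i (m i)) x.
  move=> fz gP mP /equiv_inftyP xc; apply/equiv_inftyP => r.
  have [N NP] := m_infty (r + k); have [N' NP'] := xc (r + k).
  exists (maxn N N') => i j; rewrite !geq_max => /andP[Ni N'i] /andP[_ N'j].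
  apply: le_trans (fz _ _ (x i)); rewrite lerBrDr le_min NP'// andbT.
  rewrite /gromov_product (metric_sym _ z) (metric_sym (x i) z).
  rewrite (geodesic_path_distl (gP i))// (geodesic_path_distr (gP i))//.
  by have := NP i Ni; lra.
exists y; split.
  have -> : hfst \o y = fun k => g1 k (m k).
    by apply/funext => k /=; case: (yP k).
  exact: equiv_infty_base (follow _ _ _ _ _ f1 g1P m1 c1).
have -> : hsnd \o y = fun k => g2 k (m k).
  by apply/funext => k /=; case: (yP k).
exact: equiv_infty_base (follow _ _ _ _ _ f2 g2P m2 c2).
Qed.

Lemma hyperbolic_four_point (R : realType) (M : metricType R) :
  geodesic_space M -> hyperbolic_space M ->
  exists k : R, forall z : M, four_point z k.
Proof.
move=> gM [delta d0 hM]; exists (3 * delta) => z.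
exact: delta_hyperbolic_four_point.
Qed.

Theorem theorem1 (R : realType) (X1 X2 : metricType R) (z1 : X1) (z2 : X2) :
  proper_space X1 -> geodesic_space X1 -> hyperbolic_space X1 ->
  proper_space X2 -> geodesic_space X2 -> hyperbolic_space X2 ->
  exists (Y : metricType R) (i : Y -> eprod X1 X2),
    is_interior_space (hyperbolic_product z1 z2) i /\
    [/\ proper_space Y, geodesic_space Y, hyperbolic_space Y &
      forall (b1 : X1) (b2 : X2) (b : Y),
        homeomorphic (boundary b) (boundary b1 * boundary b2)%type].
Proof.
move=> pX1 gX1 hX1 pX2 gX2 hX2.
have [k1 f1] := hyperbolic_four_point gX1 hX1.
have [k2 f2] := hyperbolic_four_point gX2 hX2.
exists (hproduct z1 z2 gX1 gX2), (@inner_space_val _ _ _ _).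
have s2_gt0 : 0 < Num.sqrt 2 :> R by rewrite sqrtr_gt0.
have gY : geodesic_space (hproduct z1 z2 gX1 gX2) by exact: hproduct_geodesic.
split; first exact: inner_space_is_interior.
split => //; first exact: hproduct_proper.
  have [|o _] := @hproduct_surj _ _ _ z1 z2 gX1 gX2 z1 z2.
    by rewrite !mdistxx.
  have [C CP] := hproduct_gromov_comparison pX1 pX2 (f1 z1) (f2 z2) z1 z2 o.
  have [k k0] := comparison_four_point s2_gt0 (f1 z1) (f2 z2) CP.
  exact: four_point_hyperbolic.
move=> b1 b2 b.
have [C CP] := hproduct_gromov_comparison pX1 pX2 (f1 z1) (f2 z2) b1 b2 b.
apply: (boundary_product_homeomorphic s2_gt0 (f1 b1) (f2 b2) CP).
exact: (hproduct_surj_infty gX1 gX2 (f1 z1) (f2 z2)).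
Qed.
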